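(* Assume the Generalised Riemann Hypothesis for all Dedekind zeta functions. Let $r,s,t,k$ be natural numbers (positive integers), and let $P_i(\mathbf x)\in \mathbb Z[x_1,\ldots ,x_s]$ $(1\le i\le r)$ be polynomials each of degree at most $t$, and with $\|P_i\|_1\le k$ $(1\le i\le r)$. Suppose that $\mathcal A$ is a finite set of algebraic numbers with $A=\mathrm{card}(\mathcal A)$ and $d(\mathcal A)\le (2t)^{2^A}$. Then $\mathcal A$ is algebraic Freiman $\mathbf P$-isomorphic to a set of algebraic numbers $\mathcal B$ with \[ d(\mathcal B)\le (2t)^{2^A}\quad \text{and}\quad \mathrm{Env}(\mathcal B)\ll r^2A^{4s}(2kt)^{(2t)^{(2t)^{2^{A+6}}}}. \] Here, the implicit constant in Vinogradov's notation $\ll$ is absolute.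
   Context: For a polynomial $P$ with integer coefficients, $\|P\|_1$ is the sum of the absolute values of its coefficients. For a finite set $\mathcal C=\{c_1,\ldots,c_n\}$ of algebraic numbers, $\mathbb Q(\mathcal C)=\mathbb Q(c_1,\ldots,c_n)$ and $d(\mathcal C)=[\mathbb Q(\mathcal C):\mathbb Q]$. The minimal polynomial $m_c\in\mathbb Z[x]$ of an algebraic number $c$ is the irreducible polynomial in $\mathbb Z[x]$ with content $1$ and positive leading coefficient with $m_c(c)=0$. The algebraic enveloping radius is $\mathrm{Env}(\mathcal C)=\max\{\|m_c\|_1:c\in\mathcal C\}$. Write $\mathbf P=(P_1,\ldots,P_r)$. For finite sets $\mathcal A,\mathcal B$ of algebraic numbers (not necessarily lying in the same number field), a bijection $\psi:\mathcal A\to\mathcal B$ is an algebraic Freiman $\mathbf P$-isomorphism if, for every $(x_1,\ldots,x_s)\in\mathcal A^s$, one has $P_i(x_1,\ldots,x_s)=0$ for all $1\le i\le r$ if and only if $P_i(\psi(x_1),\ldots,\psi(x_s))=0$ for all $1\le i\le r$; if such a $\psi$ exists, $\mathcal A$ is said to be algebraic Freiman $\mathbf P$-isomorphic to $\mathcal B$. *)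

(* Defs.v *)
From HB Require Import structures.
From mathcomp Require Import all_boot all_order all_algebra all_field.
From mathcomp Require Import finmap complex zify.
(* The notations of mpoly clash with those of mathcomp-analysis. *)
From mathcomp Require Export -(notations) mpoly.
From mathcomp Require Import all_classical all_reals all_analysis summability.

Set Implicit Arguments.
Unset Strict Implicit.
Unset Printing Implicit Defensive.

Import Order.TTheory GRing.Theory Num.Theory.
Import numFieldNormedType.Exports.
Local Open Scope classical_set_scope.
Local Open Scope ring_scope.
Local Open Scope complex_scope.

(** * Polynomials with integer coefficients *)

Definition mpoly_norm1 (s : nat) (P : mpoly s int) : nat :=
  (\sum_(m <- msupp P) `|mcoeff m P|)%N.

(* [mmeasure mdeg] is multinomials' [msize]: 1 + total degree, and 0 at P = 0. *)
Definition mpoly_deg_le (s : nat) (P : mpoly s int) (t : nat) : bool :=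
  (mmeasure mdeg P <= t.+1)%N.

Definition mpoly_eval (s : nat) (P : mpoly s int) (x : 'I_s -> algC) : algC :=
  mmap intr x P.

Definition poly_norm1 (p : {poly int}) : nat := (\sum_(i < size p) `|(p`_i)%R|)%N.

(** * Algebraic numbers *)

(* [num_field_exists s] provides a number field generated over Q by preimages
   of the elements of s, together with its embedding into algC. *)
Definition ext_degree (A : {fset algC}) : nat :=
  \dim {: projT1 (num_field_exists (enum_fset A))}.

Definition irreducible_elt (R : unitRingType) (p : R) : Prop :=
  [/\ p != 0, p \isn't a GRing.unit &
      forall q r : R, p = q * r -> q \is a GRing.unit \/ r \is a GRing.unit].

(* [zcontents p] carries the sign of the leading coefficient of p, so that
   [zcontents p = 1] means content 1 and positive leading coefficient. *)
Definition is_minpolyZ (c : algC) (p : {poly int}) : Prop :=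
  [/\ irreducible_elt p, zcontents p = 1 & root (map_poly intr p) c].

Definition minpolyZ (c : algC) : {poly int} := xget 0 [set p | is_minpolyZ c p].

Lemma is_minpolyZ_ex_uniq (c : algC) : exists! p : {poly int}, is_minpolyZ c p.
Proof.
have ZtoC (p : {poly int}) : map_poly intr p =
    map_poly ratr (map_poly (intr : int -> rat) p) :> {poly algC}.
  by rewrite -map_poly_comp; apply: eq_map_poly => x /=; rewrite ratr_int.
have zcC (a : int) : zcontents a%:P = a.
  by rewrite -[a%:P]mulr1 mul_polyC zcontentsZ zcontents_monic ?monic1 ?mulr1.
have unitC (u r : {poly int}) : zcontents (u * r) = 1 -> size r = 1%N ->
    r \is a GRing.unit.
  rewrite zcontentsM => h /eqP/size_poly1P [a a0 ra].
  move: h; rewrite ra zcC => h.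
  rewrite poly_unitE size_polyC a0 coefC eqxx /=.
  by apply/unitrP; exists (zcontents u); rewrite h mulrC h.
have [m [_ mon_m] root_m] := minCpolyP c.
have [q [a a0 mq]] := rat_poly_scale m.
have q0 : q != 0.
  apply: contraTneq mon_m => q0.
  by rewrite mq q0 map_poly0 scaler0 monicE lead_coef0.
set p := zprimitive q.
have mp : m %= map_poly intr p.
  have -> : m = (a%:~R^-1 * (zcontents q)%:~R) *: map_poly intr p.
    have zq : map_poly intr q = (zcontents q)%:~R *: map_poly intr p :> {poly rat}.
      rewrite {1}[q]zpolyEprim -/p; apply/polyP=> i.
      by rewrite coef_map !coefZ coef_map /= intrM.
    by rewrite mq zq scalerA.
  by apply: eqp_scale; rewrite mulf_neq0 ?invr_eq0 ?intr_eq0 ?zcontents_eq0.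
have p1 : zcontents p = 1 by rewrite zcontents_primitive q0.
have rootE (f : {poly int}) : root (map_poly intr f) c = (p %| f).
  by rewrite ZtoC root_m (eqp_dvdl _ mp) dvdp_rat_int.
have p0 : p != 0 by rewrite zprimitive_eq0.
have size_p : (1 < size p)%N.
  rewrite -size_rat_int_poly -(eqp_size mp) -(size_map_poly (ratr : rat -> algC)).
  apply: (root_size_gt1 (a := c)); last by rewrite root_m dvdpp.
  by rewrite map_poly_eq0 monic_neq0.
have half (u v : {poly int}) : p = u * v -> p %| u -> v \is a GRing.unit.
  move=> puv pu; apply: (unitC u); rewrite -?puv //.
  have /andP[u0 v0] : (u != 0) && (v != 0) by rewrite -negb_or -mulf_eq0 -puv.
  have := dvdp_leq u0 pu; rewrite {1}puv size_mul //.
  have: (0 < size u)%N by rewrite size_poly_gt0.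
  have: (0 < size v)%N by rewrite size_poly_gt0.
  by case: (size u) => // n; case: (size v) => // k _ _ /=; lia.
have irr_p : irreducible_elt p.
  split=> //; first by rewrite poly_unitE gtn_eqF.
  move=> u v puv; have : root (map_poly intr (u * v) : {poly algC}) c.
    by rewrite rootE -puv dvdpp.
  rewrite rmorphM rootM !rootE => /orP[/(half _ _ puv)|]; first by right.
  by move: puv; rewrite mulrC => /half h /h; left.
exists p; split=> [|f [[f0 fU firr] f1]]; first by split; rewrite ?rootE ?dvdpp.
rewrite rootE => /dvdpP_int [g]; rewrite zprimitive_id => fE.
have [pU|gU] := firr _ _ fE.
  by move: pU; rewrite poly_unitE gtn_eqF.
move: gU; rewrite poly_unitE => /andP[/size_poly1P[b _ gb] _].
by move: f1; rewrite fE zcontentsM p1 mul1r gb zcC => ->; rewrite mulr1.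
Qed.

Lemma minpolyZP (c : algC) : is_minpolyZ c (minpolyZ c).
Proof.
have [p [hp _]] := is_minpolyZ_ex_uniq c.
exact: (xgetPex 0 (ex_intro (fun p => is_minpolyZ c p) p hp)).
Qed.

Definition Env (A : {fset algC}) : nat :=
  (\max_(c <- enum_fset A) poly_norm1 (minpolyZ c))%N.

(** * Algebraic Freiman isomorphisms *)

Definition freiman_iso (r s : nat) (P : 'I_r -> mpoly s int)
    (A B : {fset algC}) (psi : A -> B) : Prop :=
  bijective psi /\
  forall x : 'I_s -> A,
    (forall i, mpoly_eval (P i) (fun j => val (x j)) = 0) <->
    (forall i, mpoly_eval (P i) (fun j => val (psi (x j))) = 0).

Definition freiman_isomorphic (r s : nat) (P : 'I_r -> mpoly s int)
    (A B : {fset algC}) : Prop :=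
  exists psi : A -> B, freiman_iso P psi.

(** * Dedekind zeta functions *)

Section DedekindZeta.
Variable K : fieldExtType rat.

Definition ring_of_integers : set K :=
  [set x | integralOver (intr : int -> K) x].

Definition nonzero_ideal (I : set K) : Prop :=
  [/\ I `<=` ring_of_integers,
      exists2 x, I x & x != 0,
      forall x y, I x -> I y -> I (x + y) &
      forall a x, ring_of_integers a -> I x -> I (a * x)].

Definition coset_of_ideal (I : set K) (x : K) : set K := [set y | I (y - x)].

(* The quotient of the ring of integers by I is finite when I is nonzero. *)
Definition ideal_norm (I : set K) : nat :=
  #|` fset_set (coset_of_ideal I @` ring_of_integers)|.

Variable R : realType.

(* n ^ z = exp (z * ln n) for n > 0 *)
Definition cpow_nat (n : nat) (z : R[i]) : R[i] :=
  let l : R := ln n%:R in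
  let m := expR (complex.Re z * l) in
  (m * cos (complex.Im z * l)) +i* (m * sin (complex.Im z * l)).

(* f is the analytic continuation to C \ {1} of the sum of N(I) ^ (- z) over
   the nonzero ideals I, which converges unconditionally for Re z > 1. The
   type R[i]^o makes the scalars complex, so that [derivable] is complex
   differentiability. The value of f at the pole 1 is irrelevant. *)
Definition is_dedekind_zeta (f : R[i]^o -> R[i]^o) : Prop :=
  (forall z : R[i]^o, 1 < complex.Re z ->
     partial_sum
       (patch (fun=> 0) nonzero_ideal
          (fun I => cpow_nat (ideal_norm I) (- z) : R[i]^o))
       @ totally --> f z) /\
  (forall z : R[i]^o, z != 1 -> derivable f z 1).

End DedekindZeta.

Definition GRH (R : realType) : Prop :=
  forall (K : fieldExtType rat) (f : R[i]^o -> R[i]^o),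
    is_dedekind_zeta K f ->
    forall z : R[i]^o,
      0 < complex.Re z -> complex.Re z < 1 -> f z = 0 -> complex.Re z = 2^-1.

(* Main.v *)
Require Import Defs.
From mathcomp Require Import all_boot all_order all_algebra all_field.
From mathcomp Require Import finmap.
From mathcomp Require Import all_classical all_reals.
From HB Require Import structures.
From mathcomp Require Import all_fingroup zify.
Import Order.TTheory GRing.Theory Num.Theory.
Local Open Scope ring_scope.

(** Enumerate A as a point a = (a_0, ..., a_(n-1)), n = card A.  Whether the
    values of the P_i at a tuple of elements of A are zero is determined by
    which integer polynomials in n variables, of degree at most t and norm at
    most k, vanish at a: substitute coordinates of a for the variables of P_i.
    So it is enough to find a point b, of small degree and height, at which
    exactly the same polynomials of degree at most t and norm at most 2k vanish
    as at a; taking norm 2k includes the differences x_i - x_j, so that the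
    coordinates of b are distinct.  Only finitely many polynomial functions are
    involved, and the product G of those which do not vanish at a turns the
    conditions F(b) != 0 into the single condition G(b) != 0.

    The point b is found by elimination of one variable at a time
    ([eliminate_last]).  View the polynomials vanishing at a as polynomials in
    the last variable X over the values of the others, and let c be one of them
    that is nonzero at a, of degree m <= t.  By the Nullstellensatz in one
    variable they have a common root where G does not vanish if and only if G^m
    is outside the ideal that they generate.  Modulo c this says that the
    remainder of G^m is outside the span of their multiples by 1, X, ...,
    X^(t-1), a space of polynomials of degree less than 2t
    ([ideal_shift_span]).  At a this is witnessed by a nonzero minor, and it
    stays true wherever this minor remains nonzero and the minors of the
    spanning rows that vanish at a still vanish ([minor_witness]).  The latter
    are integer polynomials of degree at most 2t^2 in one variable less.  This
    is the initial problem again, with t replaced by 2t^2, hence (2t)^(2^n) as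
    the bound on degrees: each new coordinate is a root of a nonzero polynomial
    of degree at most the current t, and the product of these degrees is at
    most (2t)^(2^n-1).  If all polynomials vanish identically in X at a, the new
    coordinate is an integer chosen outside the roots of G; the degree of G,
    which is huge, only influences the size of this integer.

    Heights are controlled along the tower of coordinates by a common
    denominator and a bound on all conjugates ([tower_sized]).  In a number
    field of degree D a nonzero algebraic integer cannot be small at one place
    without being large at another, which bounds the inverse of the leading
    coefficient of the polynomial defining the next coordinate.  The minimal
    polynomial is then bounded by expanding it over the conjugates
    ([minpolyZ_norm_le]).  With D = (2t)^(2^n), everything is at most (2kt)^E
    with E = D^(6n+7), while the exponent to be reached is (2t)^(D^64). *)

Set Implicit Arguments.
Unset Strict Implicit.
Unset Printing Implicit Defensive.

Section Elimination.
Implicit Types (n t k g : nat) (F G : (nat -> algC) -> algC) (x a b : nat -> algC).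
Implicit Types (c : (nat -> algC) -> {poly algC}).

(** * Functions given by integer polynomials *)

Lemma size_index_enum (T : finType) : size (index_enum T) = #|T|.
Proof. by rewrite -sum1_size -sum1_card. Qed.

Definition monom_val n (m : int * (nat -> nat)) (x : nat -> algC) : algC :=
  m.1%:~R * \prod_(i < n) x i ^+ m.2 i.

(** Degree at most t and norm at most k, as a property of the function: only
    values of polynomials matter, so a sum of monomials with repetitions is as
    good as a normal form, and sums and products need no normalization.
    Points are sequences of which the first n terms are relevant, so that the
    number of variables can change without casts. *)
Definition polyfun n t k F : Prop :=
  exists L : seq (int * (nat -> nat)),
    [/\ (\sum_(m <- L) `|m.1| <= k)%N,
        all (fun m : int * (nat -> nat) => (\sum_(i < n) m.2 i <= t)%N) L &
        forall x, F x = \sum_(m <- L) monom_val n m x].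

Lemma polyfunW n t t' k k' F :
  (t <= t')%N -> (k <= k')%N -> polyfun n t k F -> polyfun n t' k' F.
Proof.
move=> tt kk [L [Lk Lt LF]]; exists L; split=> //; first exact: leq_trans kk.
by apply: sub_all Lt => m /leq_trans; apply.
Qed.

Lemma polyfun_congr n t k F G : F =1 G -> polyfun n t k F -> polyfun n t k G.
Proof. by move=> FG [L [Lk Lt LF]]; exists L; split=> // x; rewrite -FG. Qed.

Lemma polyfun_local n t k F x y :
  (forall i, (i < n)%N -> x i = y i) -> polyfun n t k F -> F x = F y.
Proof.
move=> xy [L [_ _ LF]]; rewrite !LF; apply: eq_bigr => m _; congr (_ * _).
by apply: eq_bigr => i _; rewrite xy.
Qed.

Lemma polyfun_int n (z : int) : polyfun n 0 `|z| (fun=> z%:~R).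
Proof.
exists [:: (z, fun=> 0%N)]; split=> [|/=|x]; rewrite ?big_seq1 ?big1_eq //.
by rewrite /monom_val big1 ?mulr1.
Qed.

Lemma polyfun0 n t k : polyfun n t k (fun=> 0).
Proof. exact: polyfunW (polyfun_int n 0). Qed.

Lemma polyfun1 n : polyfun n 0 1 (fun=> 1).
Proof. exact: (polyfun_int n 1). Qed.

Lemma polyfun_var n i : (i < n)%N -> polyfun n 1 1 (fun x => x i).
Proof.
move=> lti; exists [:: (1, fun j => (j == i : nat))].
split=> [|/=|x]; rewrite ?big_seq1 ?andbT //.
  by rewrite (bigD1 (Ordinal lti)) //= eqxx big1 // => j /negPf; rewrite -val_eqE /= => ->.
rewrite /monom_val mul1r (bigD1 (Ordinal lti)) //= eqxx big1 ?mulr1 //.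
by move=> j /negPf; rewrite -val_eqE /= => ->.
Qed.

Lemma polyfunN n t k F : polyfun n t k F -> polyfun n t k (fun x => - F x).
Proof.
move=> [L [Lk Lt LF]]; exists [seq (- m.1, m.2) | m <- L]; split=> [||x].
- by rewrite big_map; under eq_bigr do rewrite abszN.
- by rewrite all_map.
- rewrite big_map LF -sumrN; apply: eq_bigr => m _.
  by rewrite /monom_val /= rmorphN mulNr.
Qed.

Lemma polyfunD n t k k' F G : polyfun n t k F -> polyfun n t k' G ->
  polyfun n t (k + k') (fun x => F x + G x).
Proof.
move=> [L [Lk Lt LF]] [M [Mk Mt MG]]; exists (L ++ M); split=> [||x].
- by rewrite big_cat leq_add.
- by rewrite all_cat Lt.
- by rewrite big_cat LF MG.
Qed.

Lemma polyfunM n t t' k k' F G : polyfun n t k F -> polyfun n t' k' G ->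
  polyfun n (t + t') (k * k') (fun x => F x * G x).
Proof.
move=> [L [Lk Lt LF]] [M [Mk Mt MG]].
exists [seq (p.1 * q.1, fun i => (p.2 i + q.2 i)%N) | p <- L, q <- M].
split=> [||x].
- rewrite big_allpairs_dep; apply: leq_trans (leq_mul Lk Mk).
  rewrite big_distrl leq_sum // => p _ /=; rewrite big_distrr leq_sum // => q _ /=.
  by rewrite abszM.
- apply/all_allpairsP => p q pL qM /=; rewrite big_split leq_add //.
    exact: (allP Lt).
  exact: (allP Mt).
- rewrite big_allpairs_dep LF MG mulr_suml; apply: eq_bigr => p _.
  rewrite mulr_sumr; apply: eq_bigr => q _ /=; rewrite /monom_val /= rmorphM /= mulrACA.
  by congr (_ * _); rewrite -big_split; apply: eq_bigr => i _; rewrite exprD.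
Qed.

Lemma polyfun_sum n t k (I : Type) (r : seq I) (P : pred I) (F : I -> (nat -> algC) -> algC) :
  (forall i, P i -> polyfun n t k (F i)) ->
  polyfun n t (count P r * k) (fun x => \sum_(i <- r | P i) F i x).
Proof.
move=> PF; elim: r => [|i r IH].
  by apply: polyfun_congr (polyfun0 _ _ _) => x; rewrite big_nil.
case Pi: (P i); last first.
  by rewrite /= Pi; apply: polyfun_congr IH => x; rewrite big_cons Pi.
rewrite /= Pi mulnDl mul1n; apply: polyfun_congr (polyfunD (PF i Pi) IH) => x.
by rewrite big_cons Pi.
Qed.

Lemma polyfun_prod n t k (I : Type) (r : seq I) (P : pred I) (F : I -> (nat -> algC) -> algC) :
  (forall i, P i -> polyfun n t k (F i)) ->
  polyfun n (count P r * t) (k ^ count P r) (fun x => \prod_(i <- r | P i) F i x).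
Proof.
move=> PF; elim: r => [|i r IH].
  by apply: polyfun_congr (polyfun1 _) => x; rewrite big_nil.
case Pi: (P i); last first.
  by rewrite /= Pi; apply: polyfun_congr IH => x; rewrite big_cons Pi.
rewrite /= Pi mulnDl mul1n expnD expn1.
apply: polyfun_congr (polyfunM (PF i Pi) IH) => x.
by rewrite big_cons Pi.
Qed.

Lemma polyfunX n t k e F : polyfun n t k F -> polyfun n (e * t) (k ^ e) (fun x => F x ^+ e).
Proof.
move=> HF; have := @polyfun_prod n t k _ (index_enum 'I_e) xpredT (fun=> F) (fun _ _ => HF).
rewrite count_predT size_index_enum card_ord; apply: polyfun_congr => x.
by rewrite prodr_const card_ord.
Qed.

(** Leibniz expansion: the m! terms are products of m entries. *)
Lemma polyfun_det n t k m (M : (nat -> algC) -> 'M[algC]_m) :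
  (forall i j, polyfun n t k (fun x => M x i j)) ->
  polyfun n (m * t) (m`! * k ^ m) (fun x => \det (M x)).
Proof.
move=> HM; rewrite /determinant.
have := @polyfun_sum n (m * t) (k ^ m) _ (index_enum {perm 'I_m}) xpredT
  (fun s x => (-1) ^+ s * \prod_i M x i (s i)).
rewrite count_predT size_index_enum card_Sn; apply => s _.
suff H : polyfun n (m * t) (k ^ m) (fun x => \prod_i M x i (s i)).
  case: (perm.odd_perm s); last first.
    by apply: polyfun_congr H => x; rewrite expr0 mul1r.
  by apply: polyfun_congr (polyfunN H) => x; rewrite expr1 mulN1r.
have := @polyfun_prod n t k _ (index_enum 'I_m) xpredT (fun i x => M x i (s i))
  (fun i _ => HM i (s i)).
by rewrite count_predT size_index_enum card_ord.
Qed.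

(** Polynomials of degree at most d in one variable, with coefficients in
    Z[x_0, ..., x_(n-1)]; the argument is the value of the coefficient variables. *)
Definition polyfam n t k d (c : (nat -> algC) -> {poly algC}) : Prop :=
  (forall x, (size (c x) <= d.+1)%N) /\
  forall i, polyfun n t k (fun x => (c x)`_i).

Lemma polyfamW n t t' k k' d d' c :
  (t <= t')%N -> (k <= k')%N -> (d <= d')%N -> polyfam n t k d c -> polyfam n t' k' d' c.
Proof.
move=> tt kk dd [sz co]; split=> [x|i]; last exact: polyfunW (co i).
exact: leq_trans (sz x) _.
Qed.

Lemma polyfam_local n t k d c x y :
  (forall i, (i < n)%N -> x i = y i) -> polyfam n t k d c -> c x = c y.
Proof. by move=> xy [_ co]; apply/polyP => i; apply: polyfun_local xy (co i). Qed.

Lemma polyfun_last n t k F : polyfun n.+1 t k F ->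
  exists2 c, polyfam n t k t c & forall x, F x = (c x).[x n].
Proof.
move=> [L [Lk Lt LF]].
pose c (x : nat -> algC) : {poly algC} :=
  \sum_(m <- L) monom_val n m x *: ('X^(m.2 n) : {poly algC}).
have le_deg (m : nat -> nat) : (\sum_(i < n.+1) m i <= t -> \sum_(i < n) m i <= t /\ m n <= t)%N.
  by rewrite big_ord_recr /=; lia.
exists c; last first.
  move=> x; rewrite LF horner_sum; apply: eq_bigr => m _.
  by rewrite !hornerE /monom_val big_ord_recr /= mulrA.
split=> [x|i].
  rewrite /c big_seq; apply: (leq_trans (size_sum _ _ _)); apply/bigmax_leqP_seq => m mL _.
  rewrite (leq_trans (size_scale_leq _ _)) // size_polyXn ltnS.
  by case: (le_deg _ (allP Lt m mL)).
exists [seq m <- L | m.2 n == i]; split=> [||x].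
- rewrite big_filter; apply: leq_trans Lk.
  by rewrite [leqRHS](bigID (fun m => m.2 n == i)) leq_addr.
- rewrite all_filter; apply: sub_all Lt => m /le_deg[lem _].
  exact/implyP.
- rewrite big_filter coef_sum [RHS]big_mkcond; apply: eq_bigr => m _.
  by rewrite coefZ coefXn eq_sym; case: eqP; rewrite ?mulr1 ?mulr0.
Qed.

(** For polynomials that are only required not to vanish, the degree matters
    and the coefficients do not. *)
Definition polyfun_deg n t F : Prop := exists k, polyfun n t k F.

(** * Ideals in one variable, and minors *)

Section Ideal.
Variables (I : Type) (s : I -> {poly algC}).

Definition in_ideal (p : {poly algC}) : Prop :=
  exists L : seq ({poly algC} * I), p = \sum_(l <- L) l.1 * s l.2.

Lemma in_ideal_gen i : in_ideal (s i).
Proof. by exists [:: (1, i)]; rewrite big_seq1 mul1r. Qed.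

Lemma in_idealD p q : in_ideal p -> in_ideal q -> in_ideal (p + q).
Proof. by move=> [L ->] [M ->]; exists (L ++ M); rewrite big_cat. Qed.

Lemma in_idealM p q : in_ideal q -> in_ideal (p * q).
Proof.
move=> [L ->]; exists [seq (p * l.1, l.2) | l <- L].
by rewrite big_map mulr_sumr; apply: eq_bigr => l _; rewrite mulrA.
Qed.

Lemma in_ideal_dvd p q : in_ideal p -> p %| q -> in_ideal q.
Proof. by move=> pI /divpK <-; apply: in_idealM. Qed.

Lemma in_idealB p q : in_ideal p -> in_ideal q -> in_ideal (p - q).
Proof. by move=> pI qI; rewrite -[- q]mulN1r; apply/in_idealD/in_idealM. Qed.

(** A nonzero element of minimal size divides all generators, since their
    remainders are in the ideal. The family may be infinite. *)
Lemma ideal_principal i0 : s i0 != 0 ->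
  exists h, [/\ in_ideal h, h != 0 & forall i, h %| s i].
Proof.
move=> si0; pose P n := `[< exists h, [/\ in_ideal h, h != 0 & size h = n] >].
have exP : exists n, P n.
  by exists (size (s i0)); apply/asboolP; exists (s i0); split=> //; apply: in_ideal_gen.
case: (ex_minnP exP) => n /asboolP[h [hI h0 <-]] min_h; exists h; split=> // i.
apply/modp_eq0P/eqP; apply: contraTT isT => r0.
have := min_h (size (s i %% h)); rewrite leqNgt ltn_modp h0; apply.
apply/asboolP; exists (s i %% h); split=> //.
have -> : s i %% h = s i - s i %/ h * h.
  by rewrite [X in X - _](divp_eq (s i) h) addrAC subrr add0r.
by apply: in_idealB; [apply: in_ideal_gen | apply: in_idealM].
Qed.

(** The generator h of the ideal has at most [(size (s i0)).-1] roots counted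
    with multiplicity, and each of them is a root of G; so that power of G is a
    multiple of h. *)
Lemma ideal_nullstellensatz i0 (G : {poly algC}) : s i0 != 0 ->
    (forall y, (forall i, root (s i) y) -> root G y) ->
  in_ideal (G ^+ (size (s i0)).-1).
Proof.
move=> si0 GV; have [h [hI h0 hs]] := ideal_principal si0.
apply: (in_ideal_dvd hI).
have [r Dh] := closed_field_poly_normal h.
have sz_h : size h = (size r).+1.
  by rewrite Dh size_scale ?lead_coef_eq0 // size_prod_XsubC.
have sz_r : (size r <= (size (s i0)).-1)%N.
  by have := dvdp_leq si0 (hs i0); rewrite sz_h; case: (size (s i0)).
apply: (@dvdp_trans _ (G ^+ size r)); last exact: dvdp_exp2l.
rewrite Dh dvdpZl ?lead_coef_eq0 //.
have: {in r, forall z, 'X - z%:P %| G}.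
  move=> z zr; rewrite dvdp_XsubCl; apply: GV => i.
  rewrite -dvdp_XsubCl; apply: dvdp_trans (hs i); rewrite dvdp_XsubCl Dh rootZ ?lead_coef_eq0 //.
  by rewrite root_prod_XsubC.
elim: r {Dh sz_h sz_r} => [|z r IH] rG; first by rewrite big_nil dvd1p.
rewrite big_cons exprS; apply: dvdp_mul; first exact/rG/mem_head.
by apply: IH => y yr; apply: rG; rewrite inE yr orbT.
Qed.

(** The part of the ideal obtained with cofactors of degree less than t, as a
    linear span: membership in it is a condition on ranks of matrices. *)
Definition in_shift_span t (p : {poly algC}) : Prop :=
  exists L : seq (algC * ('I_t * I)),
    p = \sum_(l <- L) l.1 *: ('X^(l.2.1) * s l.2.2).

Lemma shift_spanD t p q : in_shift_span t p -> in_shift_span t q -> in_shift_span t (p + q).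
Proof. by move=> [L ->] [M ->]; exists (L ++ M); rewrite big_cat. Qed.

Lemma shift_spanM t (p : {poly algC}) i : (size p <= t)%N -> in_shift_span t (p * s i).
Proof.
move=> sz_p; exists [seq (p`_(nat_of_ord j), (j, i)) | j <- enum 'I_t].
rewrite big_map big_enum /= -[in LHS](coefK p) poly_def mulr_suml.
rewrite (big_ord_widen _ (fun j : nat => p`_j *: 'X^j * s i) sz_p) big_mkcond /=.
apply: eq_bigr => j _; case: ltnP => lj; first by rewrite -scalerAl.
by rewrite nth_default // scale0r.
Qed.

(** Cofactors can be reduced modulo [s i0], which has degree at most t; the
    quotients are collected in the cofactor of [s i0], and the degree of that
    one is bounded because p and the other terms have small degree. *)
Lemma ideal_shift_span t i0 (p : {poly algC}) : (forall i, (size (s i) <= t.+1)%N) ->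
  (size p < size (s i0))%N -> in_ideal p -> in_shift_span t p.
Proof.
move=> sz_s sz_p [L Dp].
have s0 : s i0 != 0 by rewrite -size_poly_gt0; apply: leq_ltn_trans sz_p.
pose v0 : {poly algC} := \sum_(l <- L) (l.1 %/ s i0) * s l.2.
pose L1 : seq ({poly algC} * I) := (v0, i0) :: [seq (l.1 %% s i0, l.2) | l <- L].
have Dp1 : p = \sum_(l <- L1) l.1 * s l.2.
  rewrite big_cons big_map /= mulr_suml -big_split Dp; apply: eq_bigr => l _ /=.
  by rewrite {1}(divp_eq l.1 (s i0)) mulrDl mulrAC.
have sz0 := sz_s i0.
have sz_mod (l : {poly algC}) : (size (l %% s i0)%R < size (s i0)%R)%N by rewrite ltn_modp.
have sz_v0 : (size v0 <= t)%N.
  have [->|v00] := eqVneq v0 0; first by rewrite size_poly0.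
  have Dv : v0 * s i0 = p - \sum_(l <- L) (l.1 %% s i0) * s l.2.
    by rewrite Dp1 big_cons big_map /= addrK.
  have : (size (v0 * s i0)%R <= (size (s i0)).-1 + t)%N.
    rewrite Dv (leq_trans (size_polyD _ _)) // geq_max size_polyN; apply/andP; split; first by lia.
    elim/big_ind: _ => [|u v su sv|l _]; first by rewrite size_poly0.
      by rewrite (leq_trans (size_polyD _ _)) // geq_max su.
    apply: (leq_trans (size_polyMleq _ _)); have := sz_mod l.1; have := sz_s l.2.
    by move: (size _) (size _) (size _) => *; lia.
  move: (s0); rewrite size_mul // -size_poly_gt0.
  by move: (size (s i0)) (size v0) => *; lia.
rewrite Dp1 big_cons big_map; apply: shift_spanD; first exact: shift_spanM.
elim/big_ind: _ => [||l _]; first by exists [::]; rewrite big_nil.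
  exact: shift_spanD.
by apply: shift_spanM; have := sz_mod l.1; move: (size _) (size _) sz0 => *; lia.
Qed.
End Ideal.

Section Minors.
Variable K : fieldType.

Lemma row_free_minor p w (B : 'M[K]_(p, w)) : row_free B ->
  exists h : 'I_p -> 'I_w, \det (colsub h B) != 0.
Proof.
rewrite -[row_free B]/(\rank B == p) -mxrank_tr => fB; have fB' : row_full B^T by [].
exists (fullrankfun fB').
have := fullrowsub_full fB'; rewrite row_full_unit unitmxE unitfE -det_tr.
by rewrite trmx_mxsub trmxK.
Qed.

Lemma minor_row_free p w (B : 'M[K]_(p, w)) (h : 'I_p -> 'I_w) :
  \det (colsub h B) != 0 -> row_free B.
Proof.
rewrite -unitfE -unitmxE -row_free_unit -!kermx_eq0 => /eqP k0.
apply/eqP/row_matrixP => i; rewrite row0; apply/eqP.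
rewrite -submx0 -k0; apply/sub_kermxP.
rewrite mulmx_colsub -row_mul mulmx_ker.
by apply/matrixP => ? ?; rewrite !mxE.
Qed.

(** Takes a maximal independent set of rows at a, of cardinal rho, and adjoins
    r. If [delta b != 0] and r(b) were in the span of rows at b, there would be
    more than rho independent rows at b, hence a nonzero minor of rows at b of
    size greater than rho; it would be nonzero at a, against maximality. *)
Lemma minor_witness (I X : Type) w (rw : I -> X -> 'rV[K]_w) (r : X -> 'rV[K]_w) (a : X) :
    (forall L : seq (K * I), r a <> \sum_(l <- L) l.1 *: rw l.2 a) ->
  exists rho (f : 'I_rho -> I) (h : 'I_(rho + 1) -> 'I_w),
    let delta (x : X) := \det (colsub h (col_mx (\matrix_i rw (f i) x) (r x))) in
    [/\ (rho < w)%N, delta a != 0 &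
    forall b : X,
      (forall m (f' : 'I_m -> I) (h' : 'I_m -> 'I_w), (m <= w)%N ->
        \det (\matrix_(i, j) rw (f' i) a 0 (h' j)) = 0 ->
        \det (\matrix_(i, j) rw (f' i) b 0 (h' j)) = 0) ->
      delta b != 0 ->
      forall L : seq (K * I), r b <> \sum_(l <- L) l.1 *: rw l.2 b].
Proof.
move=> ra.
pose P rho := `[< exists f : 'I_rho -> I, row_free (\matrix_i rw (f i) a) >].
have exP : exists rho, P rho.
  exists 0; apply/asboolP.
  have f0 : 'I_0 -> I by case.
  by exists f0; rewrite -[row_free _]/(\rank _ == 0) -leqn0 rank_leq_row.
have leP rho : P rho -> (rho <= w)%N.
  by move=> /asboolP[f]; rewrite -[row_free _]/(\rank _ == rho) => /eqP <-; apply: rank_leq_col.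
case: (ex_maxnP exP leP) => rho /asboolP[f ff] max_rho.
pose Ma := \matrix_i rw (f i) a.
have rank_a : \rank Ma = rho by apply/eqP.
have r_notin : ~~ (r a <= Ma)%MS.
  apply/negP => /submxP[v rv]; apply: (ra [seq (v 0 i, f i) | i <- enum 'I_rho]).
  rewrite big_map big_enum /= rv mulmx_sum_row; apply: eq_bigr => i _.
  by rewrite rowK.
have ra' : row_free (col_mx Ma (r a)).
  rewrite -row_leq_rank -addsmxE addn1 -[X in (X < _)%N]rank_a.
  have : (Ma < Ma + r a)%MS by rewrite ltmxE addsmxSl addsmx_sub submx_refl.
  by rewrite ltmxErank => /andP[].
have [h dh] := row_free_minor ra'.
exists rho, f, h; split=> //.
  by have := rank_leq_col (col_mx Ma (r a)); rewrite (eqP ra') addn1.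
move=> b minors /minor_row_free fb L rL.
pose Mb := \matrix_i rw (f i) b.
pose l0 i := tnth (in_tuple L) i.
pose N := \matrix_(i < size L) rw (l0 i).2 b.
pose B := col_mx Mb N.
have sub_B : (col_mx Mb (r b) <= B)%MS.
  rewrite -!addsmxE addsmx_sub addsmxSl /= (submx_trans _ (addsmxSr _ _)) // rL.
  rewrite big_tnth summx_sub // => i _; apply: scalemx_sub.
  by rewrite -[X in (X <= _)%MS](rowK (fun i => rw (l0 i).2 b)) row_sub.
have rank_B : (rho < \rank B)%N.
  by have := mxrankS sub_B; rewrite (eqP fb) addn1.
pose f' i := match fintype.split (maxrankfun B i) with inl j => f j | inr j => (l0 j).2 end.
have DB : rowsub (maxrankfun B) B = \matrix_i rw (f' i) b.
  apply/row_matrixP => i; rewrite rowK row_rowsub /f'.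
  by case: split_ordP => j ->; rewrite ?rowKu ?rowKd rowK.
have := maxrowsub_free B; rewrite DB => /row_free_minor[h'].
have colsubE (x : X) : colsub h' (\matrix_i rw (f' i) x) = \matrix_(i, j) rw (f' i) x 0 (h' j).
  by apply/matrixP => i j; rewrite !mxE.
rewrite colsubE => dB; have /eqP : \det (\matrix_(i, j) rw (f' i) a 0 (h' j)) != 0.
  by apply: contraNN dB => /eqP/minors ->; rewrite // rank_leq_col.
rewrite -colsubE => /eqP/minor_row_free fa.
have : (\rank B <= rho)%N by apply: max_rho; apply/asboolP; exists f'.
by rewrite leqNgt rank_B.
Qed.
End Minors.

(** * Pseudo-division *)

Lemma polyfun_degW n g g' F : (g <= g')%N -> polyfun_deg n g F -> polyfun_deg n g' F.
Proof. by move=> gg [k Fk]; exists k; apply: polyfunW Fk. Qed.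

Lemma polyfun_degB n g F G :
  polyfun_deg n g F -> polyfun_deg n g G -> polyfun_deg n g (fun x => F x - G x).
Proof. by move=> [k Fk] [l Gl]; exists (k + l)%N; apply/polyfunD/polyfunN. Qed.

Lemma polyfun_degM n g g' F G :
  polyfun_deg n g F -> polyfun_deg n g' G -> polyfun_deg n (g + g') (fun x => F x * G x).
Proof. by move=> [k Fk] [l Gl]; exists (k * l)%N; apply: polyfunM. Qed.

Lemma polyfun_deg_sum n g m (F : 'I_m -> (nat -> algC) -> algC) :
  (forall i, polyfun_deg n g (F i)) -> polyfun_deg n g (fun x => \sum_(i < m) F i x).
Proof.
move=> /choice[k Fk]; exists (m * \max_i k i)%N.
rewrite -[m in (m * _)%N]card_ord -(size_index_enum 'I_m) -count_predT.
apply: polyfun_sum => i _; apply: polyfunW (Fk i) => //.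
exact: (leq_bigmax (F := k)).
Qed.

Lemma polyfun_deg_det n g m (M : (nat -> algC) -> 'M[algC]_m) :
  (forall i j, polyfun_deg n g (fun x => M x i j)) ->
  polyfun_deg n (m * g) (fun x => \det (M x)).
Proof.
move=> HM; have /choice[k Mk] : forall ij : 'I_m * 'I_m,
  exists k, polyfun n g k (fun x => M x ij.1 ij.2) by move=> [i j]; apply: HM.
exists (m`! * (\max_ij k ij) ^ m)%N; apply: polyfun_det => i j.
by apply: polyfunW (Mk (i, j)) => //; apply: (leq_bigmax (F := k)).
Qed.

(** Analogue of [polyfam] with [polyfun_deg] in place of [polyfun]. *)
Definition coef_deg n g (p : (nat -> algC) -> {poly algC}) : Prop :=
  forall i, polyfun_deg n g (fun x => (p x)`_i).

Lemma coef_degM n g g' (p q : (nat -> algC) -> {poly algC}) :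
  coef_deg n g p -> coef_deg n g' q -> coef_deg n (g + g') (fun x => p x * q x).
Proof.
move=> Hp Hq i.
have [k Hk] := polyfun_deg_sum (fun j : 'I_i.+1 => polyfun_degM (Hp j) (Hq (i - j)%N)).
by exists k; apply: polyfun_congr Hk => x; rewrite coefM.
Qed.

Lemma coef_degX n g (p : (nat -> algC) -> {poly algC}) m :
  coef_deg n g p -> coef_deg n (m * g) (fun x => p x ^+ m).
Proof.
move=> Hp; elim: m => [|m IH] i.
  exists 1%N; apply: polyfun_congr (polyfunW _ _ (polyfun_int n (i == 0)%N)) => // [x|].
    by rewrite expr0 coef1.
  by case: eqP.
have [k Hk] := coef_degM Hp IH i; exists k; rewrite mulSn.
by apply: polyfun_congr Hk => x; rewrite exprS.
Qed.

(** Division by [take_poly m.+1 (c x)] after multiplication by a power of the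
    coefficient of degree m, which is the leading one at the points of
    interest. One step kills the top coefficient and raises degrees by t. *)
Lemma pseudo_remainder n t k c m N g (p : (nat -> algC) -> {poly algC}) :
    (forall i, polyfun n t k (fun x => (c x)`_i)) ->
    (forall x, (size (p x) <= N)%N) -> coef_deg n g p ->
  exists r : (nat -> algC) -> {poly algC},
    [/\ forall x, (size (r x) <= m)%N, coef_deg n (g + N * t) r &
    forall x, exists q : {poly algC},
      (c x)`_m ^+ N *: p x = q * take_poly m.+1 (c x) + r x].
Proof.
move=> Hc; elim: N g p => [|N IH] g p sz_p Hp.
  exists p; split=> [x||x]; rewrite ?(leq_trans (sz_p x)) ?mul0n ?addn0 //.
  by exists 0; rewrite scale1r mul0r add0r.
have Hl : polyfun_deg n t (fun x => (c x)`_m) by exists k.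
have [lt_mN | le_Nm] := leqP m N; last first.
  exists (fun x => (c x)`_m ^+ N.+1 *: p x); split=> [x|i|x].
  - by rewrite (leq_trans (size_scale_leq _ _)) // (leq_trans (sz_p x)).
  - have [l Hl'] := Hp i.
    exists (k ^ N.+1 * l)%N; rewrite addnC.
    by apply: polyfun_congr (polyfunM (polyfunX N.+1 (Hc m)) Hl') => x; rewrite coefZ.
  - by exists 0; rewrite mul0r add0r.
pose ct x := take_poly m.+1 (c x).
pose p1 x : {poly algC} := (c x)`_m *: p x - (p x)`_N *: ('X^(N - m) * ct x).
have sz_p1 x : (size (p1 x) <= N)%N.
  have sz_ct : (size (ct x) <= m.+1)%N by apply: size_take_poly.
  apply/leq_sizeP => i le_Ni; rewrite /p1 coefB !coefZ coefXnM.
  rewrite ltnNge (leq_trans (leq_subr _ _) le_Ni) /=.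
  have [<-|ltNi] := eqVneq N i; first by rewrite subKn // coef_take_poly ltnSn mulrC subrr.
  rewrite [(p x)`_i]nth_default ?(leq_trans (sz_p x)) 1?ltn_neqAle ?ltNi // mulr0.
  by rewrite [(ct x)`_(_ - _)]nth_default ?mulr0 ?subrr // (leq_trans sz_ct) //; lia.
have Hp1 : coef_deg n (t + g) p1.
  move=> i; have H1 := polyfun_degM Hl (Hp i).
  have Hct : polyfun_deg n t (fun x => ('X^(N - m) * ct x)`_i).
    have [lt_i | le_i] := ltnP i (N - m).
      exists k; apply: polyfun_congr (polyfun0 _ _ _) => x.
      by rewrite coefXnM lt_i.
    have [lt_m | le_m] := ltnP (i - (N - m)) m.+1; exists k; last first.
      apply: polyfun_congr (polyfun0 _ _ _) => x.
      by rewrite coefXnM ltnNge le_i /= coef_take_poly ltnNge le_m.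
    apply: polyfun_congr (Hc (i - (N - m))%N) => x.
    by rewrite coefXnM ltnNge le_i /= coef_take_poly lt_m.
  have H2 := polyfun_degM Hct (Hp N).
  have [l Hl'] := polyfun_degB H1 H2; exists l; apply: polyfun_congr Hl' => x.
  by rewrite /p1 coefB !coefZ [X in _ - X]mulrC.
have [r [sz_r Hr Dr]] := IH _ _ sz_p1 Hp1; exists r; split=> // [i|x].
  by apply: polyfun_degW (Hr i); rewrite mulSn addnCA addnA.
have [q Dq] := Dr x.
exists (q + (c x)`_m ^+ N *: ((p x)`_N *: 'X^(N - m))).
rewrite exprSr -scalerA -[(c x)`_m *: _](subrK ((p x)`_N *: ('X^(N - m) * ct x))) -/(p1 x).
by rewrite scalerDr Dq mulrDl addrAC -!scalerAl.
Qed.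

(** * Elimination of the last coordinate *)

(** b is a specialization of a as far as polynomials of degree at most t and
    norm at most k are concerned. *)
Definition specializes n t k a b : Prop :=
  forall F, polyfun n t k F -> F a = 0 -> F b = 0.

Definition update x n (y : algC) : nat -> algC := fun i => if i == n then y else x i.

Lemma polyfam_update n t k d c x y :
  polyfam n t k d c -> c (update x n y) = c x.
Proof. by apply: polyfam_local => i; rewrite /update => /ltn_eqF ->. Qed.

(** A nonzero polynomial of degree at most g has at most g roots. *)
Lemma nonroot_nat (p : {poly algC}) g : p != 0 -> (size p <= g.+1)%N ->
  exists2 y : nat, (y <= g)%N & ~~ root p y%:R.
Proof.
move=> p0 sz_p; pose rs : seq algC := [seq y%:R | y <- iota 0 g.+1].
have [all_r|] := boolP (all (root p) rs).
  have u_rs : uniq rs.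
    by rewrite map_inj_uniq ?iota_uniq // => i j /eqP; rewrite eqr_nat => /eqP.
  by have := max_poly_roots p0 all_r u_rs; rewrite size_map size_iota ltnNge sz_p.
rewrite -has_predC => /hasP[z /mapP[y y_in ->] /= ny].
move: y_in; rewrite mem_iota ltnS => /andP[_ le_y].
by exists y.
Qed.

(** A minor of size 2t is a sum of (2t)! products of 2t entries. *)
Definition next_norm t k := ((2 * t)`! * k ^ (2 * t))%N.
Definition next_deg t := (2 * t * t)%N.
(** Degree of a determinant of size at most 2t which involves the remainder of
    G^m, times a coefficient of degree t. *)
Definition next_ineq t g := (2 * t * (t * g + (t * g + 1) * t) + t)%N.

(** How a new coordinate y is tied to the preceding ones: the integers up to g
    are included, as roots of X - y. *)
Definition step_fam n t k g b y : Prop :=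
  exists2 c, polyfam n t (maxn k g) t c & c b != 0 /\ root (c b) y.

(** If all polynomials vanish identically in the last variable at a, then G'
    is a coefficient of G. Otherwise G' is the product of the witness minor
    and of the leading coefficient of one of the polynomials; the latter keeps
    the degree of this polynomial the same at a and b. *)
Lemma eliminate_last n t k g G a : (0 < t)%N -> (0 < k)%N ->
    polyfun_deg n.+1 g G -> G a != 0 ->
  exists G', [/\ polyfun_deg n (next_ineq t g) G', G' a != 0 &
    forall b, specializes n (next_deg t) (next_norm t k) a b -> G' b != 0 ->
      exists y, [/\ specializes n.+1 t k a (update b n y), G (update b n y) != 0 &
                    step_fam n t k g b y]].
Proof.
move=> t_gt0 k_gt0 [kG /polyfun_last[Gc famG DG]] Ga.
have le_tt : (t <= next_deg t)%N by rewrite /next_deg; nia.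
have le_kk : (k <= next_norm t k)%N.
  rewrite /next_norm -[k in (k <= _)%N]mul1n leq_mul ?fact_gt0 //.
  by rewrite -[k in (k <= _)%N]expn1 leq_pexp2l //; lia.
pose I := {c : (nat -> algC) -> {poly algC} | polyfam n t k t c /\ root (c a) (a n)}.
pose s (i : I) := sval i.
have famI i : polyfam n t k t (s i) by case: i => c [].
have rootI i : root (s i a) (a n) by case: i => c [].
have spec_last b y : (forall i, root (s i b) y) -> specializes n.+1 t k a (update b n y).
  move=> sby F /polyfun_last[c famc DF]; rewrite !DF => /eqP Fa.
  have := sby (exist _ c (conj famc Fa)); rewrite /s /= => /eqP.
  by rewrite (polyfam_update _ _ famc) /update eqxx.
have Gupd b y : G (update b n y) = (Gc b).[y].
  by rewrite DG (polyfam_update _ _ famG) /update eqxx.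
have Gca : Gc a != 0 by apply: contraNneq Ga => G0; rewrite DG G0 horner0.
(* I indexes the polynomials that vanish at the last coordinate of a. *)
have [all0|] := pselect (forall i, s i a = 0).
  have [i Gi] : exists i, (Gc a)`_i != 0.
    by exists (size (Gc a)).-1; rewrite -lead_coefE lead_coef_eq0.
  exists (fun x => (Gc x)`_i); split=> //.
    apply: polyfun_degW (ex_intro _ kG (famG.2 i)).
    by rewrite /next_ineq; nia.
  move=> b spec Gib.
  have [|y le_y yroot] := @nonroot_nat (Gc b) g _ (famG.1 b).
    by apply: contraNneq Gib => ->; rewrite coef0.
  exists y%:R; split.
  - apply: spec_last => u; suff -> : s u b = 0 by apply: root0.
    apply/polyP => j; rewrite coef0; apply: (spec (fun x => (s u x)`_j)).
      exact: polyfunW ((famI u).2 j).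
    by rewrite all0 coef0.
  - by rewrite Gupd.
  - exists (fun=> 'X - y%:R%:P); last by rewrite polyXsubC_eq0 root_XsubC eqxx.
    split=> [x|j]; first by rewrite size_XsubC.
    have co z : (`|z| <= maxn k g)%N -> polyfun n t (maxn k g) (fun=> z%:~R).
      by move=> zk; apply: polyfunW (polyfun_int n z).
    have [->|j0] := eqVneq j 0%N.
      apply: polyfun_congr (co (- y%:Z) _) => [x|]; last by rewrite abszN; lia.
      by rewrite coefB coefX coefC /= sub0r rmorphN.
    apply: polyfun_congr (co (j == 1%N) _) => [x|]; last by case: eqP; lia.
    by rewrite coefB coefX coefC (negPf j0) subr0; case: eqP.
move=> /existsNP[i0 /eqP si0].
pose m := (size (s i0 a)).-1; pose l x := (s i0 x)`_m.
have sz0 : size (s i0 a) = m.+1 by rewrite /m prednK // size_poly_gt0.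
have le_mt : (m <= t)%N by have := (famI i0).1 a; rewrite sz0.
have la : l a != 0 by rewrite /l -lead_coefE lead_coef_eq0.
pose N := (t * g + 1)%N.
have sz_Gm x : (size (Gc x ^+ m) <= N)%N.
  rewrite (leq_trans (size_poly_exp_leq _ _)) // /N.
  have := famG.1 x; case: (size (Gc x)) => [|u] /=; nia.
have degGm : coef_deg n (t * g) (fun x => Gc x ^+ m).
  move=> i; have dG : coef_deg n g Gc by move=> j; exists kG; apply: famG.2.
  by apply: polyfun_degW (coef_degX m dG i); nia.
have [r [sz_r deg_r Dr]] := pseudo_remainder m (famI i0).2 sz_Gm degGm.
have sz_shift (j : 'I_t) i x : (size ('X^j * s i x)%R <= 2 * t)%N.
  rewrite (leq_trans (size_polyMleq _ _)) // size_polyXn.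
  by have := (famI i).1 x; have := ltn_ord j; move: (size _) (nat_of_ord j) => *; lia.
pose rw (ji : 'I_t * I) x : 'rV[algC]_(2 * t) := poly_rV ('X^(ji.1) * s ji.2 x).
pose rr x : 'rV[algC]_(2 * t) := poly_rV (r x).
have rrE x (L : seq (algC * ('I_t * I))) : rr x = \sum_(l <- L) l.1 *: rw l.2 x <->
    r x = \sum_(l <- L) l.1 *: ('X^(l.2.1) * s l.2.2 x).
  split=> [rL|rL].
    have sz_rx : (size (r x) <= 2 * t)%N by rewrite (leq_trans (sz_r x)) //; lia.
    rewrite -(poly_rV_K sz_rx) -/(rr x) rL linear_sum; apply: eq_bigr => u _.
    by rewrite linearZ /= poly_rV_K // sz_shift.
  by rewrite /rr rL linear_sum; apply: eq_bigr => u _; rewrite linearZ.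
(* Elements of the ideal vanish at the last coordinate of a, and G does not. *)
have ra L : rr a <> \sum_(l <- L) l.1 *: rw l.2 a.
  move/rrE => rL; have [q Dq] := Dr a.
  have : ((s i0 a)`_m ^+ N *: Gc a ^+ m).[a n] = 0.
    rewrite Dq hornerD hornerM take_poly_id ?sz0 // (rootP (rootI i0)) mulr0 add0r rL.
    rewrite horner_sum big1 // => u _.
    by rewrite hornerZ hornerM (rootP (rootI _)) !mulr0.
  move/eqP; rewrite hornerZ horner_exp -DG mulf_eq0 !expf_eq0.
  by rewrite (negPf Ga) [_ == 0](negPf la) !andbF.
have [rho [f [h]]] := minor_witness ra.
set delta := fun x => _ => -[lt_rho delta_a Hdelta].
have rwE x j i u : rw (j, i) x 0 u = if (u < j)%N then 0 else (s i x)`_(u - j).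
  by rewrite mxE coefXnM.
have poly_rw ji u : polyfun n t k (fun x => rw ji x 0 u).
  case: ji => j i; have [ltu|leu] := ltnP u j.
    by apply: polyfun_congr (polyfun0 _ _ _) => x; rewrite rwE ltu.
  apply: polyfun_congr ((famI i).2 (u - j)%N) => x.
  by rewrite rwE ltnNge leu.
have deg_delta : polyfun_deg n ((rho + 1) * (t * g + N * t)) delta.
  apply: polyfun_deg_det => i j.
  have [i' ->|i' ->] := split_ordP i.
    exists k; apply: polyfun_congr (polyfunW _ (leqnn k) (poly_rw (f i') (h j))) => [x|].
      by rewrite [RHS]mxE /= col_mxEu [RHS]mxE.
    by rewrite /N; nia.
  have [kr Hkr] := deg_r (h j); exists kr; apply: polyfun_congr Hkr => x.
  by rewrite [RHS]mxE /= col_mxEd [RHS]mxE.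
exists (fun x => delta x * l x); split.
- have deg_l : polyfun_deg n t l by exists k; apply: (famI i0).2.
  apply: polyfun_degW (polyfun_degM deg_delta deg_l).
  by rewrite /next_ineq -/N leq_add2r leq_mul2r; apply/orP; right; lia.
- by rewrite mulf_neq0.
move=> b spec; rewrite mulf_eq0 negb_or => /andP[delta_b lb].
have minors_b m' (f' : 'I_m' -> 'I_t * I) (h' : 'I_m' -> 'I_(2 * t)) : (m' <= 2 * t)%N ->
    \det (\matrix_(i, j) rw (f' i) a 0 (h' j)) = 0 ->
    \det (\matrix_(i, j) rw (f' i) b 0 (h' j)) = 0.
  move=> le_m'; apply: (spec (fun x => \det (\matrix_(i, j) rw (f' i) x 0 (h' j)))).
  apply: polyfunW (polyfun_det (n := n) (t := t) (k := k) _) => [||i j].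
  - by rewrite /next_deg leq_mul2r le_m' orbT.
  - by rewrite leq_mul ?leq_pexp2l // leq_fact.
  - by apply: polyfun_congr (poly_rw (f' i) (h' j)) => x; rewrite mxE.
have rb := Hdelta b minors_b delta_b.
(* Coefficients above m vanish at a, hence at b. *)
have sz0b : size (s i0 b) = m.+1.
  apply/eqP; rewrite eqn_leq ltnNge; apply/andP; split.
    apply/leq_sizeP => j lt_mj; apply: (spec (fun x => (s i0 x)`_j)).
      exact: polyfunW ((famI i0).2 j).
    by rewrite nth_default // sz0.
  by apply: contra lb => sz_m; rewrite /l nth_default.
have sb0 : s i0 b != 0 by rewrite -size_poly_gt0 sz0b.
have [y [sby Gby]] : exists y, (forall i, root (s i b) y) /\ ~~ root (Gc b) y.
  apply: contrapT => /forallNP noy.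
  have GV y : (forall i, root (s i b) y) -> root (Gc b) y.
    by move=> sby; apply: contraPT (noy y) => Gby []; split.
  have := ideal_nullstellensatz (s := fun i => s i b) (i0 := i0) sb0 GV; rewrite sz0b /= => GI.
  have [q Dq] := Dr b.
  have rI : in_ideal (fun i => s i b) (r b).
    have -> : r b = l b ^+ N *: Gc b ^+ m - q * s i0 b.
      by rewrite /l Dq take_poly_id ?sz0b // addrAC subrr add0r.
    apply: in_idealB; last exact/in_idealM/in_ideal_gen.
    by rewrite -mul_polyC; apply: in_idealM.
  have [||L rL] := @ideal_shift_span _ _ t i0 _ _ _ rI.
  - by move=> i; apply: (famI i).1.
  - by rewrite sz0b ltnS sz_r.
  - by apply: (rb L); apply/rrE.
exists y; split; first exact: spec_last.
  by rewrite Gupd.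
exists (s i0) => //; by apply: polyfamW (famI i0); rewrite ?leq_maxl.
Qed.

(** * Towers of algebraic numbers *)

(** Each coordinate is a root of a nonzero polynomial whose coefficients are
    integer polynomials in the preceding coordinates. *)
Definition tower n (d : nat -> nat) t k b : Prop :=
  forall i, (i < n)%N ->
    exists2 c, polyfam i t k (d i) c & c b != 0 /\ root (c b) (b i).

(** The bound g occurs because an integer coordinate y <= g enters as a
    coefficient of X - y. *)
Fixpoint tower_norm n t k g : nat :=
  if n is n'.+1 then
    maxn (maxn k g) (tower_norm n' (next_deg t) (next_norm t k) (next_ineq t g))
  else 1.

(** Elimination of all coordinates. One step replaces 2t by (2t)^2, so that
    [2 ^ n] in the exponent is preserved, and the product of the degrees is
    bounded by t * (4t^2)^(2^n - 1) <= (2t)^(2^(n+1) - 1). *)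
Theorem specialize_to_tower n t k g G a : (0 < t)%N -> (0 < k)%N ->
    polyfun_deg n g G -> G a != 0 ->
  exists b d, [/\ specializes n t k a b, G b != 0,
    tower n d ((2 * t) ^ (2 ^ n)) (tower_norm n t k g) b,
    (forall i, (i < n)%N -> (0 < d i)%N) &
    (\prod_(i < n) d i <= (2 * t) ^ (2 ^ n - 1))%N].
Proof.
elim: n t k g G => [|n IH] t k g G t0 k0 polyG Ga.
  by exists a, (fun=> 0); split=> //; rewrite big_ord0.
have [G' [polyG' Ga' HG']] := eliminate_last t0 k0 polyG Ga.
have [||b [d [spec Gb tow d0 prod_d]]] :=
  IH (next_deg t) (next_norm t k) (next_ineq t g) G' _ _ polyG' Ga'.
- by rewrite !muln_gt0 t0.
- by rewrite muln_gt0 fact_gt0 expn_gt0 k0.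
have [y [specy Gy [c famc [cb0 cby]]]] := HG' b spec Gb.
have E2 : (2 * next_deg t = (2 * t) ^ 2)%N by rewrite /next_deg; lia.
have E3 : ((2 * next_deg t) ^ 2 ^ n = (2 * t) ^ 2 ^ n.+1)%N.
  by rewrite E2 -expnM expnS.
have upd i : (i < n)%N -> update b n y i = b i by rewrite /update => /ltn_eqF ->.
exists (update b n y), (fun i => if i == n then t else d i); split=> //.
- move=> i; rewrite ltnS leq_eqVlt => /predU1P[-> | lt_in].
    exists c; last by rewrite (polyfam_update _ _ famc) /update eqxx.
    rewrite eqxx; apply: polyfamW famc; rewrite ?leq_maxl //.
    rewrite -[t in (t <= _)%N]expn1.
    by rewrite (leq_trans (leq_pexp2l _ (expn_gt0 2 n.+1))) // ?leq_exp2r //; lia.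
  have [c' famc' [c'b c'y]] := tow i lt_in.
  have c'E : c' (update b n y) = c' b.
    by apply: polyfam_local famc' => j lt_ji; apply/upd/(ltn_trans lt_ji).
  exists c'; last by rewrite c'E upd.
  rewrite (ltn_eqF lt_in); apply: polyfamW famc'; rewrite ?leq_maxr //.
  by rewrite E3.
- move=> i; rewrite ltnS leq_eqVlt => /predU1P[-> | lt_in]; first by rewrite eqxx.
  by rewrite (ltn_eqF lt_in) d0.
rewrite big_ord_recr /= eqxx.
under eq_bigr do rewrite (ltn_eqF (ltn_ord _)).
apply: leq_trans (leq_mul prod_d (leqnn t)) _.
have -> : (2 ^ n.+1 - 1 = (2 ^ n - 1) * 2 + 1)%N.
  by have := expn_gt0 2 n; rewrite expnS; lia.
rewrite E2 -expnM [(2 * (_ - _))%N]mulnC expnD expn1.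
by rewrite leq_mul //; lia.
Qed.

End Elimination.

(** * Conjugates *)

Section NumberField.
Variables (Q : fieldExtType rat) (QC : {rmorphism Q -> algC}).

Lemma polyOver1_rat (p : {poly Q}) : p \is a polyOver 1%VS ->
  exists q : {poly rat}, p = map_poly (in_alg Q) q.
Proof.
move=> /polyOverP p1; have /choice[a pa] : forall i, exists a : rat, p`_i = a%:A.
  by move=> i; apply/vlineP.
exists (\poly_(i < size p) a i); apply/polyP => i; rewrite coef_map coef_poly /=.
by case: ltnP => [_|/leq_sizeP -> //]; rewrite ?pa ?rmorph0 ?scale0r.
Qed.

Lemma map_in_alg_ratr (q : {poly rat}) :
  map_poly QC (map_poly (in_alg Q) q) = map_poly ratr q.
Proof.
rewrite -map_poly_comp; apply: eq_map_poly => a.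
by rewrite /= rmorphZ_num rmorph1 mulr1.
Qed.

Lemma minCpoly_minPoly z : exists2 q : {poly rat},
  minPoly 1 z = map_poly (in_alg Q) q & minCpoly (QC z) %| map_poly ratr q.
Proof.
have [q Dq] := polyOver1_rat (minPolyOver 1 z); exists q => //.
have [r [-> _] rP] := minCpolyP (QC z).
rewrite dvdp_map -rP -map_in_alg_ratr -Dq fmorph_root; exact: root_minPoly.
Qed.

Lemma size_minCpoly_dim z : (size (minCpoly (QC z)) <= (\dim {:Q}).+1)%N.
Proof.
have [q Dq dq] := minCpoly_minPoly z.
have q0 : q != 0.
  by apply: contraNneq (monic_neq0 (monic_minPoly 1 z)) => q0; rewrite Dq q0 rmorph0.
apply: (leq_trans (dvdp_leq _ dq)); first by rewrite map_poly_eq0.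
rewrite size_map_poly -(size_map_poly (in_alg Q)) -Dq size_minPoly ltnS.
have := dim_Fadjoin 1%AS z; rewrite dimv1 muln1 => <-.
exact/dimvS/subvf.
Qed.
End NumberField.

(** The field generated by the roots of the minimal polynomial of x is normal;
    the isomorphism of Q(x) onto Q(y) extends to it, then to all algebraic
    numbers. *)
Lemma root_minCpoly_aut x y : root (minCpoly x) y ->
  exists nu : {rmorphism algC -> algC}, nu x = y.
Proof.
move=> xy; have [p [Dp mon_p] _] := minCpolyP x.
have [r Dr] := closed_field_poly_normal (minCpoly x).
rewrite (monicP (minCpoly_monic x)) scale1r in Dr.
have [Qr [QrC [rr Drr genQr]]] := num_field_exists r.
have lift z : root (minCpoly x) z -> exists zz, QrC zz = z.
  by rewrite Dr root_prod_XsubC -Drr => /mapP[zz]; exists zz.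
have [xx Dx] := lift x (root_minCpoly x); have [yy Dy] := lift y xy.
have min_yy : root (minPoly 1 xx) yy.
  have [q Dq dq] := minCpoly_minPoly QrC xx.
  rewrite -(fmorph_root QrC) Dq map_in_alg_ratr Dy.
  by rewrite -dvdp_XsubCl (dvdp_trans _ dq) // dvdp_XsubCl Dx.
have hom1 : kHom 1 <<1; xx>> (kHomExtend 1 \1 xx yy).
  by rewrite kHomExtendP ?kHom1 // lfun1_poly.
pose pr := map_poly (in_alg Qr) p.
have Qpr: pr \is a polyOver 1%VS.
  by apply/polyOverP=> i; rewrite coef_map memvZ ?memv_line.
have splitQr: splittingFieldFor <<1; xx>> pr fullv.
  apply: splittingFieldForS (sub1v _) (subvf _) _; exists rr => //.
  congr (_ %= _): (eqpxx pr); apply/(map_poly_inj QrC).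
  rewrite map_in_alg_ratr -Dp Dr -Drr big_map rmorph_prod /=; apply: eq_bigr => zz _.
  by rewrite map_polyXsubC.
have [f homf Df] := kHom_extends (sub1v _) hom1 Qpr splitQr.
pose fM := GRing.isMonoidMorphism.Build _ _ f (kHom_monoid_morphism homf).
pose phi : {rmorphism _ -> _} := HB.pack (fun_of_lfun f) fM.
have [nu Dnu] := extend_algC_subfield_aut QrC phi.
exists nu; rewrite -Dx -Dnu /= -Df ?memv_adjoin //.
rewrite (kHomExtend_val (kHom1 1 1)) ?Dy //.
by rewrite lfun1_poly.
Qed.

(** * Degree of a tower *)

Section TowerDegree.
Variables (Q : fieldExtType rat) (QC : {rmorphism Q -> algC}).

Lemma polyfun_subfield (K : {subfield Q}) n t k (F : (nat -> algC) -> algC) (b : nat -> algC) :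
    (forall i, (i < n)%N -> exists2 z, z \in K & QC z = b i) ->
  polyfun n t k F -> exists2 z, z \in K & QC z = F b.
Proof.
move=> bK [L [_ _ LF]].
have /choice[z zP] : forall i, exists z, (i < n)%N -> z \in K /\ QC z = b i.
  move=> i; have [/bK[z zK Dz]|_] := boolP (i < n)%N; first by exists z.
  by exists 0.
exists (\sum_(m <- L) m.1%:~R * \prod_(i < n) z i ^+ m.2 i).
  apply: rpred_sum => m _; apply: rpredM; first exact: rpred_int.
  by apply: rpred_prod => i _; apply: rpredX; case: (zP i (ltn_ord i)).
rewrite LF rmorph_sum; apply: eq_bigr => m _; rewrite rmorphM rmorph_int rmorph_prod.
by congr (_ * _); apply: eq_bigr => i _; rewrite rmorphXn; case: (zP i (ltn_ord i)) => _ ->.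
Qed.

(** The degree of an extension by one element is at most the degree of any
    nonzero polynomial that vanishes at it. *)
Lemma tower_dim n d t k (b : nat -> algC) (z : nat -> Q) : tower n d t k b ->
  (forall i, (i < n)%N -> QC (z i) = b i) ->
  (\dim <<1 & mkseq z n>> <= \prod_(i < n) d i)%N.
Proof.
elim: n => [|n IH] tow zb.
  by rewrite big_ord0 /mkseq /= Fadjoin_nil dimv1.
have [c famc [cb0 cbn]] := tow n (ltnSn n).
pose K : {subfield Q} := <<1 & mkseq z n>>%AS.
rewrite mkseqS adjoin_rcons -/K dim_Fadjoin big_ord_recr /= mulnC.
apply: leq_mul.
  by apply: IH => i lt_in; [apply: tow | apply: zb]; apply: ltnW.
have /choice[w wP] : forall i, exists w, w \in K /\ QC w = (c b)`_i.
  move=> i; have [|w wK Dw] := polyfun_subfield (K := K) (b := b) _ (famc.2 i).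
    move=> j lt_jn; exists (z j); last by apply/zb/ltnW.
    by apply/seqv_sub_adjoin/map_f; rewrite mem_iota.
  by exists w.
pose p := \poly_(i < (d n).+1) w i.
have Dp : map_poly QC p = c b.
  apply/polyP => i; rewrite coef_map coef_poly; case: ltnP => [_|le_i].
    by case: (wP i).
  by rewrite [RHS]nth_default ?(leq_trans (famc.1 b)) //; apply: rmorph0.
have p0 : p != 0 by rewrite -(map_poly_eq0 QC) Dp.
have pK : p \is a polyOver K.
  by apply: polyOver_poly => i _; case: (wP i).
have pz : root p (z n) by rewrite -(fmorph_root QC) Dp zb.
have := dvdp_leq p0 (minPoly_dvdp pK pz); rewrite size_minPoly => le_n.
by rewrite -ltnS (leq_trans le_n) // size_poly.
Qed.
End TowerDegree.

Lemma tower_size_minCpoly n d t k (b : nat -> algC) m t' k' F : tower n d t k b ->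
  (m <= n)%N -> polyfun m t' k' F ->
  (size (minCpoly (F b)) <= (\prod_(i < n) d i).+1)%N.
Proof.
move=> tow le_mn polyF.
have [Q [QC [s Ds genQ]]] := num_field_exists (mkseq b n).
have sz_s : size s = n by rewrite -(size_map QC) Ds size_mkseq.
have zb i : (i < n)%N -> QC s`_i = b i.
  by move=> lt_in; rewrite -(nth_map _ 0) ?sz_s // Ds nth_mkseq.
have [|w _ <-] := polyfun_subfield (QC := QC) (K := {:Q}%AS) (b := b) _ polyF.
  move=> i lt_im; exists s`_i; first exact: memvf.
  by rewrite zb // (leq_trans lt_im).
apply: (leq_trans (size_minCpoly_dim QC w)); rewrite ltnS -genQ.
have := tower_dim tow zb; congr (\dim _ <= _)%N; congr <<1 & _>>%VS.
by rewrite -sz_s -/(mkseq _ _) mkseq_nth.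
Qed.

(** * Denominators and conjugates of roots *)

(** The house of x is the largest absolute value of its conjugates; these are
    the images of x by automorphisms of the field of algebraic numbers, which
    makes the house compatible with sums and products. *)
Definition house_le (M : nat) (x : algC) : Prop :=
  forall nu : {rmorphism algC -> algC}, `|nu x| <= M%:R.

Lemma house_le_conj M x y : root (minCpoly x) y -> house_le M x -> house_le M y.
Proof.
by move=> /root_minCpoly_aut[nu <-] hx sigma; apply: (hx (sigma \o nu)).
Qed.

Lemma house_leW M M' x : (M <= M')%N -> house_le M x -> house_le M' x.
Proof. by move=> le_M hx nu; rewrite (le_trans (hx nu)) // ler_nat. Qed.

Lemma norm_prod_le (r : seq algC) (f : algC -> algC) (M : nat) :
  {in r, forall z, `|f z| <= M%:R} -> `|\prod_(z <- r) f z| <= (M ^ size r)%:R.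
Proof.
elim: r => [|z r IH] fM; first by rewrite big_nil normr1.
rewrite big_cons normrM expnS natrM ler_pM ?fM ?mem_head //.
by apply: IH => y yr; apply: fM; rewrite inE yr orbT.
Qed.

Lemma Aint_conj x y : root (minCpoly x) y -> x \in Aint -> y \in Aint.
Proof. by move=> /root_minCpoly_aut[nu <-]; rewrite Aint_aut. Qed.

(** N is the absolute value of the norm of x over Q(x), and mu is, up to sign,
    the product of the other conjugates. Since N >= 1, a bound on mu is a lower
    bound on x. *)
Lemma Aint_norm_multiple x (M D : nat) : x \in Aint -> x != 0 -> (0 < M)%N ->
    house_le M x -> (size (minCpoly x) <= D.+1)%N ->
  exists N mu, [/\ (0 < N <= M ^ D)%N, mu \in Aint, house_le (M ^ D) mu & N%:R = x * mu].
Proof.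
move=> Ax x0 M0 hx sz.
have [r Dr] := closed_field_poly_normal (minCpoly x).
rewrite (monicP (minCpoly_monic x)) scale1r in Dr.
have rootE z : root (minCpoly x) z = (z \in r) by rewrite Dr root_prod_XsubC.
have sz_r : (size r <= D)%N by move: sz; rewrite Dr size_prod_XsubC.
have xr : x \in r by rewrite -rootE root_minCpoly.
pose r' := rem x r.
have perm_r := perm_to_rem xr.
pose P := \prod_(z <- r) z.
have DP : P = x * \prod_(z <- r') z by rewrite /P (perm_big _ perm_r) big_cons.
have r'r : {subset r' <= r} by apply: mem_rem.
have r0 z : z \in r -> z != 0.
  by rewrite -rootE => /root_minCpoly_aut[nu <-]; rewrite fmorph_eq0.
have P0 : P != 0.
  by rewrite /P prodf_seq_neq0; apply/allP => z zr; rewrite r0.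
have PZ : P \in Num.int.
  have : (minCpoly x)`_0 \in Num.int by apply: (polyOverP Ax).
  rewrite -horner_coef0 Dr horner_prod.
  under eq_bigr do rewrite hornerXsubC sub0r -mulN1r.
  rewrite big_split /= -/P big_const_seq iter_mulr_1 => PZ.
  have -> : P = (-1) ^+ count xpredT r * ((-1) ^+ count xpredT r * P).
    by rewrite mulrA -expr2 sqrr_sign mul1r.
  by rewrite rpredM // rpredX // rpredN rpred1.
have [z Dz] := intrP PZ.
have z0 : z != 0 by apply: contraNneq P0; rewrite Dz => ->.
have hN (s : seq algC) (nu : {rmorphism algC -> algC}) : {subset s <= r} ->
    `|\prod_(y <- s) nu y| <= (M ^ size s)%:R.
  by move=> sr; apply: norm_prod_le => y /sr; rewrite -rootE => /house_le_conj/(_ hx).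
(* The sign makes N positive. *)
exists `|z|%N, ((sgz z)%:~R * \prod_(y <- r') y); split.
- have := hN r idfun (fun _ => id); rewrite /= -/P Dz => hP.
  rewrite absz_gt0 z0 -(ler_nat algC) /=.
  have -> : `|z|%N%:R = `|z%:~R| :> algC by rewrite -intr_norm -natr_absz.
  by rewrite (le_trans hP) // ler_nat leq_pexp2l.
- rewrite rpredM ?rpred_int // big_seq.
  by apply: rpred_prod => y /r'r; rewrite -rootE => /Aint_conj ->.
- move=> nu; rewrite rmorphM rmorph_int rmorph_prod normrM -intr_norm.
  rewrite [X in X * _](_ : _ = 1) ?mul1r; last by rewrite normr_sgz z0.
  rewrite (le_trans (hN r' nu r'r)) // ler_nat leq_pexp2l // size_rem //.
  by rewrite (leq_trans (leq_pred _)).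
- rewrite mulrCA -DP Dz -rmorphM /= -[sgz z * z](_ : `|z|%N%:Z = _) //.
  by rewrite abszE normrEsg.
Qed.

Lemma Aint_integralOver x : x \in Aint -> integralOver (intr : int -> algC) x.
Proof.
move=> /floorpP[q Dq]; exists q; last by rewrite -Dq root_minCpoly.
have := minCpoly_monic x; rewrite Dq !monicE lead_coef_map_inj //; last exact: intr_inj.
by rewrite (_ : 1 = 1%:~R :> algC) // eqr_int.
Qed.

Lemma integralOver_Aint x : integralOver (intr : int -> algC) x -> x \in Aint.
Proof.
move=> [p mon_p px]; apply: root_monic_Aint px _ _; first exact: monic_map.
by apply/polyOverP => i; rewrite coef_map rpred_int.
Qed.

(** Multiplying the equation by a power of the leading coefficient l makes it
    monic in l * x. *)
Lemma Aint_lead_root (p : {poly algC}) x :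
  p != 0 -> root p x -> p \is a polyOver Aint -> lead_coef p * x \in Aint.
Proof.
move=> p0 px /polyOverP Ap; set l := lead_coef p.
have Al : l \in Aint by apply: Ap.
have [m sz] : exists m, size p = m.+2.
  by have := root_size_gt1 p0 px; case: (size p) => [|[|m]] // _; exists m.
(* l^m * p(x) as a monic polynomial in l * x *)
pose r : {poly algC} := 'X^(m.+1) + \poly_(i < m.+1) (p`_i * l ^+ (m - i)).
have mon_r : r \is monic.
  by rewrite monicE lead_coefDl ?lead_coefXn // size_polyXn ltnS size_poly.
have Ar : r \is a polyOver Aint.
  rewrite rpredD ?polyOverXn //; apply: polyOver_poly => i _.
  by rewrite rpredM ?rpredX.
apply/integralOver_Aint/(integral_root_monic mon_r).
  rewrite rootE hornerD hornerXn horner_poly.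
  apply/eqP; transitivity (l ^+ m * p.[x]); last by rewrite (rootP px) mulr0.
  rewrite [in RHS]horner_coef sz [in RHS]big_ord_recr /= mulrDr [RHS]addrC; congr (_ + _).
    by rewrite [p`_m.+1](_ : _ = l) ?exprMn ?exprSr ?mulrA // /l lead_coefE sz.
  rewrite mulr_sumr; apply: eq_bigr => i _; rewrite exprMn [LHS]mulrA -[p`_i * _ * _]mulrA -exprD.
  by rewrite subnK -1?ltnS // [p`_i * _]mulrC mulrA.
by apply/integral_poly => i; apply/Aint_integralOver/(polyOverP Ar).
Qed.

(** Cauchy's bound on roots, for a root outside the open unit disk. *)
Lemma root_norm_le (p : {poly algC}) (y : algC) (V : nat) :
    p != 0 -> root p y -> (forall i, `|p`_i| <= V%:R) -> 1 <= `|y| ->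
  `|lead_coef p| * `|y| <= ((size p).-1 * V)%:R.
Proof.
move=> p0 py pV y1.
have [m sz] : exists m, size p = m.+2.
  by have := root_size_gt1 p0 py; case: (size p) => [|[|m]] // _; exists m.
have ym0 : 0 < `|y| ^+ m by rewrite exprn_gt0 // (lt_le_trans ltr01).
rewrite sz /= lead_coefE sz /= -(ler_pM2r ym0) -mulrA -exprS -normrX -normrM.
have := rootP py; rewrite horner_coef sz big_ord_recr /= addrC => /eqP; rewrite addr_eq0 => /eqP ->.
rewrite normrN natrM -mulrA mulr_natl -[X in _ *+ X]card_ord -sumr_const.
apply: (le_trans (ler_norm_sum _ _ _)); apply: ler_sum => i _.
rewrite normrM normrX; apply: ler_pM; rewrite ?exprn_ge0 //.
by apply: ler_weXn2l => //; rewrite -ltnS.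
Qed.

Definition sized (q M : nat) (x : algC) : Prop := q%:R * x \in Aint /\ house_le M x.

(** The denominator q' is the norm N of q times the leading coefficient, and N
    is also what bounds the leading coefficient below in Cauchy's bound. *)
Lemma root_sized (p : {poly algC}) x (d q V D : nat) :
    p != 0 -> (size p <= d.+1)%N -> root p x -> (forall i, sized q V p`_i) ->
    (0 < q)%N -> (0 < V)%N -> (size (minCpoly (q%:R * lead_coef p)%R) <= D.+1)%N ->
  exists2 q', (0 < q' <= (q * V) ^ D)%N & sized q' (1 + d * V * q * (q * V) ^ D) x.
Proof.
move=> p0 sz_p px pi q0 V0 szD.
have q0' : q%:R != 0 :> algC by rewrite pnatr_eq0 -lt0n.
have Ag : q%:R * lead_coef p \in Aint by case: (pi (size p).-1).
have g0 : q%:R * lead_coef p != 0 by rewrite mulf_neq0 // lead_coef_eq0.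
have hg : house_le (q * V) (q%:R * lead_coef p).
  move=> nu; rewrite rmorphM rmorph_nat normrM normr_nat natrM ler_wpM2l ?ler0n //.
  by case: (pi (size p).-1) => _; apply.
have qV0 : (0 < q * V)%N by rewrite muln_gt0 q0.
have [N [mu [/andP[N0 leN] Amu hmu DN]]] := Aint_norm_multiple Ag g0 qV0 hg szD.
exists N; first by rewrite N0.
have Agx : q%:R * lead_coef p * x \in Aint.
  rewrite -lead_coefZ; apply: Aint_lead_root.
  - by rewrite scaler_eq0 negb_or q0'.
  - by rewrite rootZ.
  - by apply/polyOverP => i; rewrite coefZ; case: (pi i).
split; first by rewrite DN mulrAC rpredM.
move=> nu; have [y1|y1] := real_leP (normr_real (nu x)) (real1 _).
  by rewrite (le_trans y1) // natrD ler_wpDr.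
rewrite natrD ler_wpDl // [X in _ <= X]natrM.
pose pn := map_poly nu p.
have pn0 : pn != 0 by rewrite map_poly_eq0.
have rn : root pn (nu x) by rewrite fmorph_root.
have hV i : `|pn`_i| <= V%:R by rewrite coef_map; case: (pi i) => _; apply.
have := root_norm_le pn0 rn hV (ltW y1); rewrite lead_coef_map size_map_poly => H.
have : 1 <= `|nu mu| * `|nu (q%:R * lead_coef p)|.
  by rewrite -normrM -rmorphM mulrC -DN rmorph_nat normr_nat ler1n.
rewrite rmorphM rmorph_nat normrM normr_nat => H1.
have {}H1 : `|nu x| <= `|nu mu| * q%:R * (`|nu (lead_coef p)| * `|nu x|).
  rewrite mulrA ler_peMl // -mulrA //.
apply: (le_trans H1).
have H2 : `|nu (lead_coef p)| * `|nu x| <= (d * V)%:R.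
  by rewrite (le_trans H) // ler_nat leq_mul //; move: sz_p; case: (size p).
rewrite (natrM _ (d * V)) mulrC -mulrA; apply: ler_pM; rewrite ?mulr_ge0 // mulrC.
by apply: ler_pM.
Qed.

(** * Height of a tower *)

Lemma sizedW q q' M M' x : (q %| q')%N -> (M <= M')%N -> sized q M x -> sized q' M' x.
Proof.
move=> /dvdnP[u ->] le_M [Ax hx]; split; last exact: house_leW hx.
by rewrite natrM -mulrA rpredM // rpred_nat.
Qed.

Lemma polyfun_sized n t k q M F (b : nat -> algC) : (0 < M)%N ->
    polyfun n t k F -> (forall i, (i < n)%N -> sized q M (b i)) ->
  sized (q ^ t) (k * M ^ t) (F b).
Proof.
move=> M0 [L [Lk Lt ->]] hb; split.
  rewrite mulr_sumr big_seq; apply: rpred_sum => m /(allP Lt) le_t.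
  rewrite /monom_val mulrCA rpredM ?rpred_int //.
  rewrite -(subnK le_t) expnD natrM -mulrA rpredM ?rpred_nat //.
  rewrite expn_sum natr_prod -big_split /=; apply: rpred_prod => i _.
  by rewrite natrX -exprMn rpredX //; case: (hb i (ltn_ord i)).
move=> nu; rewrite rmorph_sum; apply: (le_trans (ler_norm_sum _ _ _)).
apply: (@le_trans _ _ (\sum_(m <- L) (`|m.1| * M ^ t)%:R)); last first.
  by rewrite -natr_sum -big_distrl /= ler_nat leq_mul.
rewrite !big_seq; apply: ler_sum => m /(allP Lt) le_t.
rewrite /monom_val rmorphM rmorph_int rmorph_prod normrM natrM -intr_norm -natr_absz.
apply: ler_pM => //.
apply: (@le_trans _ _ (M ^ \sum_(i < n) m.2 i)%:R); last by rewrite ler_nat leq_pexp2l.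
rewrite expn_sum natr_prod normr_prod; apply: ler_prod => i _.
rewrite normr_ge0 /= rmorphXn normrX natrX lerXn2r // ?nnegrE //.
by case: (hb i (ltn_ord i)) => _; apply.
Qed.

(** Denominators and houses of the first n coordinates, from [root_sized]. *)
Fixpoint tower_size t k D n : nat :=
  if n is n'.+1 then (D.+1 * (k * tower_size t k D n' ^ (2 * t)) ^ D.+1)%N else 1.

Lemma tower_sized n d t k D (b : nat -> algC) : (0 < t)%N -> (0 < k)%N ->
    (forall i, (i < n)%N -> (0 < d i)%N) -> (\prod_(i < n) d i <= D)%N ->
    tower n d t k b ->
  exists2 q, (0 < q <= tower_size t k D n)%N &
    forall i, (i < n)%N -> sized q (tower_size t k D n) (b i).
Proof.
move=> t0 k0 d0 prodD tow.
have dD i : (i < n)%N -> (d i <= D)%N.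
  move=> lt_in; apply: leq_trans prodD; rewrite (bigD1 (Ordinal lt_in)) //=.
  by rewrite leq_pmulr //; apply: prodn_cond_gt0 => j _; rewrite d0.
have D0 : (0 < D)%N.
  by apply: leq_trans prodD; apply: prodn_cond_gt0 => i _; rewrite d0.
suff H j : (j <= n)%N -> exists2 q, (0 < q <= tower_size t k D j)%N &
    forall i, (i < j)%N -> sized q (tower_size t k D j) (b i) by apply: H.
elim: j => [|j IH] lt_jn; first by exists 1%N.
have [q /andP[q0 le_q] hq] := IH (ltnW lt_jn).
set M := tower_size t k D j in le_q hq.
have M0 : (0 < M)%N by apply: leq_trans le_q.
have [c [sz_c famc] [cb0 cbj]] := tow j lt_jn.
have hc i : sized (q ^ t) (k * M ^ t) (c b)`_i by exact: (polyfun_sized M0 (famc i) hq).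
have qt0 : (0 < q ^ t)%N by rewrite expn_gt0 q0.
have V0 : (0 < k * M ^ t)%N by rewrite muln_gt0 k0 expn_gt0 M0.
have szD : (size (minCpoly ((q ^ t)%:R * lead_coef (c b))%R) <= D.+1)%N.
  pose m := (size (c b)).-1.
  have polyl := polyfunM (polyfun_int j (q ^ t)%N) (famc m).
  by apply: leq_trans (tower_size_minCpoly tow (ltnW lt_jn) polyl) _; rewrite ltnS.
have [q' /andP[q'0 le_q'] hbj] := root_sized cb0 (sz_c b) cbj hc qt0 V0 szD.
set W := (k * M ^ (2 * t))%N.
have le_W : (q ^ t * (k * M ^ t) <= W)%N.
  by rewrite /W mulnCA mul2n -addnn expnD !leq_mul // leq_exp2r.
have le_VW : (k * M ^ t * q ^ t <= W)%N by rewrite mulnC.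
have W0 : (0 < W)%N by apply: leq_trans le_W; rewrite muln_gt0 qt0.
have le_MW : (M <= W)%N.
  rewrite -[M]mul1n leq_mul // -[M in (M <= _)%N]expn1 leq_pexp2l //; lia.
have WD : ((q ^ t * (k * M ^ t)) ^ D <= W ^ D)%N by rewrite leq_exp2r.
have -> : tower_size t k D j.+1 = (D.+1 * W ^ D.+1)%N by [].
have le_qq : (q * q' <= D.+1 * W ^ D.+1)%N.
  rewrite expnS -[(q * q')%N]mul1n leq_mul // leq_mul //.
    exact: leq_trans le_q le_MW.
  exact: leq_trans le_q' WD.
exists (q * q')%N; first by rewrite muln_gt0 q0 q'0.
move=> i; rewrite ltnS leq_eqVlt => /predU1P[->|lt_ij].
  apply: sizedW hbj; first exact: dvdn_mull.
  rewrite mulSn leq_add ?expn_gt0 ?W0 // -mulnA -mulnA expnS.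
  apply: leq_mul; first exact: dD.
  by rewrite mulnA; apply: leq_mul; rewrite // mulnA.
apply: sizedW (hq i lt_ij); first exact: dvdn_mulr.
apply: (leq_trans le_MW); rewrite -[W in (W <= _)%N]mul1n leq_mul //.
by rewrite -[W in (W <= _)%N]expn1 leq_pexp2l.
Qed.

(** * Norm of minimal polynomials *)

(** The sum of absolute values of the coefficients is submultiplicative, and
    it is at most q (1 + M) for each factor. *)
Lemma coef_norm_prod_le (r : seq algC) (q M : nat) :
    {in r, forall z, `|z| <= M%:R} ->
  \sum_(i < (size r).+1) `|(\prod_(z <- r) (q%:R *: 'X - (q%:R * z)%:P))`_i|
    <= ((q * (1 + M)) ^ size r)%:R.
Proof.
elim: r => [|z r IH] rM; first by rewrite big_nil big_ord1 coef1 normr1.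
rewrite big_cons; set p := \prod_(_ <- _) _ in IH *.
have {}IH : \sum_(i < (size r).+1) `|p`_i| <= ((q * (1 + M)) ^ size r)%:R.
  by apply: IH => y yr; apply: rM; rewrite inE yr orbT.
have sz_p : (size p <= (size r).+1)%N.
  rewrite /p; elim: (r) => [|y s IHs]; first by rewrite big_nil size_poly1.
  rewrite big_cons (leq_trans (size_polyMleq _ _)) //=.
  have : (size ((q%:R *: 'X - (q%:R * y)%:P)%R : {poly algC}) <= 2)%N.
    rewrite (leq_trans (size_polyD _ _)) // geq_max size_polyN.
    by rewrite (leq_trans (size_scale_leq _ _)) ?size_polyX //= (leq_trans (size_polyC_leq1 _)).
  by move=> H2; have := leq_add H2 IHs; case: (_ + _)%N => [|u] /=; lia.
have co i : ((q%:R *: 'X - (q%:R * z)%:P) * p)`_i =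
    q%:R * (if i is j.+1 then p`_j else 0) - q%:R * z * p`_i.
  by rewrite mulrBl coefB -scalerAl coefZ coefXM coefCM; case: i.
under eq_bigr do rewrite co.
apply: (@le_trans _ _ (\sum_(i < (size r).+2) (q%:R * `|if val i is j.+1 then p`_j else 0|
   + q%:R * M%:R * `|p`_i|))).
  apply: ler_sum => i _; apply: (le_trans (ler_normB _ _)).
  rewrite !normrM normr_nat lerD2l ler_wpM2r // ler_wpM2l //.
  exact/rM/mem_head.
rewrite big_split /= -!mulr_sumr big_ord_recl normr0 add0r.
rewrite [X in _ * X + _](_ : _ = \sum_(i < (size r).+1) `|p`_i|) //.
rewrite [\sum_(i < (size r).+2) _]big_ord_recr /= [p`_(size r).+1]nth_default //.
rewrite normr0 addr0 -mulrDl.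
rewrite expnS natrM; apply: ler_pM => //; last by rewrite natrM natrD mulrDr mulr1.
  by rewrite addr_ge0 ?mulr_ge0.
exact: sumr_ge0.
Qed.

(** The polynomial is the product of the q * X - q * z over the conjugates z
    of x: its coefficients are algebraic integers, and rational. *)
Lemma minCpoly_int_multiple x q M D : (0 < q)%N -> sized q M x ->
    (size (minCpoly x) <= D.+1)%N ->
  exists2 p : {poly int}, (poly_norm1 p <= (q * (1 + M)) ^ D)%N &
    exists2 a : algC, a != 0 & map_poly intr p = a *: minCpoly x.
Proof.
move=> q0 [Aqx hx] szD.
have [r Dr] := closed_field_poly_normal (minCpoly x).
rewrite (monicP (minCpoly_monic x)) scale1r in Dr.
have rootE z : root (minCpoly x) z = (z \in r) by rewrite Dr root_prod_XsubC.
have q0' : q%:R != 0 :> algC by rewrite pnatr_eq0 -lt0n.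
pose R := \prod_(z <- r) (q%:R *: 'X - (q%:R * z)%:P).
have DR : R = q%:R ^+ size r *: minCpoly x.
  rewrite Dr /R; elim: (r) => [|z s IH]; first by rewrite !big_nil scale1r.
  by rewrite !big_cons IH polyCM -mul_polyC -mulrBr -!mul_polyC exprS polyCM mulrACA.
have AR : R \is a polyOver Aint.
  rewrite /R big_seq; apply: rpred_prod => z; rewrite -rootE => xz.
  have Aqz : q%:R * z \in Aint.
    have [nu <-] := root_minCpoly_aut xz.
    by rewrite -(rmorph_nat nu) -rmorphM Aint_aut.
  by rewrite rpredB ?polyOverC // polyOverZ ?polyOverX // rpred_nat.
have ZR : R \is a polyOver Num.int.
  apply/polyOverP => i; apply: Cint_rat_Aint; last exact: (polyOverP AR).
  have [p0 [Dp0 _] _] := minCpolyP x.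
  by rewrite DR coefZ Dp0 coef_map rpredM ?Crat_rat // rpredX // rpred_nat.
have /floorpP[p Dp] := ZR.
have a0 : q%:R ^+ size r != 0 :> algC by rewrite expf_neq0.
exists p; last by exists (q%:R ^+ size r) => //; rewrite -Dp.
have sz_p : size p = (size r).+1.
  rewrite -(size_map_inj_poly (intr_inj : injective (intr : int -> algC))) // -Dp DR size_scale //.
  by rewrite Dr size_prod_XsubC.
have sz_r : (size r <= D)%N by move: szD; rewrite Dr size_prod_XsubC.
have rM : {in r, forall z, `|z| <= M%:R}.
  by move=> z; rewrite -rootE => /root_minCpoly_aut[nu <-]; apply: hx.
apply: (@leq_trans ((q * (1 + M)) ^ size r)); last by rewrite leq_pexp2l // muln_gt0 q0.
rewrite -(ler_nat algC) natr_sum sz_p; apply: le_trans (coef_norm_prod_le q rM).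
apply: ler_sum => i _.
by rewrite -/R Dp coef_map /= -intr_norm -natr_absz.
Qed.

(** The primitive part of an integer multiple of the minimal polynomial is the
    minimal polynomial over Z up to sign, by Gauss's lemma. *)
Lemma minpolyZ_norm_le x q M D : (0 < q)%N -> sized q M x ->
    (size (minCpoly x) <= D.+1)%N ->
  (poly_norm1 (minpolyZ x) <= (q * (1 + M)) ^ D)%N.
Proof.
move=> q0 szd szD.
have [p le_p [a a0 Dp]] := minCpoly_int_multiple q0 szd szD.
apply: leq_trans le_p.
have [irr_f f1 rf] := minpolyZP x; set f := minpolyZ x in irr_f f1 rf *.
have [p0 [Dp0 mon_p0] p0P] := minCpolyP x.
have ZtoC (u : {poly int}) : map_poly intr u =
    map_poly ratr (map_poly (intr : int -> rat) u) :> {poly algC}.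
  by rewrite -map_poly_comp; apply: eq_map_poly => y /=; rewrite ratr_int.
have dvd_pf : map_poly (intr : int -> rat) p %| map_poly intr f.
  rewrite -(dvdp_map (ratr : {rmorphism rat -> algC})) -!ZtoC Dp dvdpZl // Dp0.
  by rewrite ZtoC dvdp_map -p0P -ZtoC.
have sz_p : (1 < size p)%N.
  rewrite -(size_map_inj_poly (intr_inj : injective (intr : int -> algC))) // Dp size_scale //.
  exact: size_minCpoly.
move: dvd_pf; rewrite dvdp_rat_int => /dvdpP_int[g fE].
have [_ _ /(_ _ _ fE)[]] := irr_f.
  by rewrite poly_unitE size_zprimitive => /andP[/eqP sz1]; rewrite sz1 in sz_p.
rewrite poly_unitE => /andP[/size_poly1P[b b0 Dg]]; rewrite Dg coefC /= => bU.
have b1 : `|b|%N = 1%N by move: bU; case: b {b0 Dg} => [[|[]]|[]].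
have c1 : (0 < `|zcontents p|)%N.
  by rewrite absz_gt0 zcontents_eq0 -size_poly_gt0 (ltn_trans _ sz_p).
rewrite /poly_norm1 fE Dg mulrC mul_polyC size_scale // size_zprimitive.
apply: leq_sum => i _; rewrite coefZ abszM b1 mul1n.
have -> : p`_i = zcontents p * (zprimitive p)`_i by rewrite -coefZ -zpolyEprim.
by rewrite abszM leq_pmull.
Qed.

(** * Numerical estimates *)

Local Close Scope ring_scope.

Lemma fact_leq_exp m : m`! <= m ^ m.
Proof.
rewrite fact_prod -[X in _ ^ X]subn0 -[m - 0]/(m.+1 - 1) -prod_nat_const_nat.
rewrite !big_nat; apply: leq_prod => i; lia.
Qed.

Lemma next_ineq_leq t g : 0 < t -> 0 < g -> next_ineq t g <= (2 * t) ^ 3 * g.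
Proof. by rewrite /next_ineq !expnS expn0; nia. Qed.

Lemma next_norm_leq t k : next_norm t k <= (2 * t * k) ^ (2 * t).
Proof. by rewrite /next_norm expnMn leq_mul // fact_leq_exp. Qed.

(** Writing k and g as powers of L, one elimination step replaces the exponent
    s by D * (D + s), so that D + s is multiplied by at most D^2. *)
Lemma tower_norm_leq L D s n t k g : 1 < L -> 2 < D -> D <= L ^ D ->
    0 < t -> 0 < g -> (2 * t) ^ (2 ^ n) <= D -> k <= L ^ s -> g <= L ^ s ->
  tower_norm n t k g <= L ^ (D ^ (2 * n) * (D + s)).
Proof.
move=> L1 D2 DL; have D1 := ltnW D2.
elim: n s t k g => [|n IH] s t k g t0 g0 tD ks gs.
  by rewrite expn_gt0 (ltnW L1).
have L0 := ltnW L1.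
have tD1 : 2 * t <= D.
  apply: leq_trans tD; rewrite -[X in X <= _]expn1 leq_pexp2l ?expn_gt0 //; lia.
have step : D + D * (D + s) <= D ^ 2 * (D + s) by rewrite expnS expn1; nia.
have le_s : L ^ s <= L ^ (D ^ (2 * n.+1) * (D + s)).
  by rewrite leq_exp2l // (leq_trans (leq_addl D s)) // leq_pmull // expn_gt0; lia.
rewrite /= !geq_max -andbA; apply/and3P; split.
- exact: leq_trans ks le_s.
- exact: leq_trans gs le_s.
apply: leq_trans (IH (D * (D + s)) _ _ _ _ _ _ _ _) _.
- by rewrite /next_deg !muln_gt0 t0.
- by rewrite /next_ineq addn_gt0 t0 orbT.
- rewrite /next_deg mulnA -[2 * (2 * t) * t](_ : (2 * t) ^ 2 = _) -?expnM -?expnS //.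
  by rewrite expnS expn1; lia.
- apply: (leq_trans (next_norm_leq _ _)); apply: (@leq_trans ((L ^ (D + s)) ^ (2 * t))).
    rewrite leq_exp2r ?muln_gt0 // expnD leq_mul // (leq_trans tD1) //.
  by rewrite -expnM leq_exp2l // mulnC leq_mul.
- apply: (leq_trans (next_ineq_leq t0 g0)); apply: (@leq_trans (L ^ (D * 3 + s))).
    rewrite expnD leq_mul // expnM leq_exp2r // (leq_trans tD1) //.
  by rewrite leq_exp2l //; nia.
rewrite leq_exp2l // (_ : 2 * n.+1 = 2 * n + 2); last lia.
by rewrite expnD -mulnA leq_mul.
Qed.

(** If the sizes are at most L^m then the next ones are at most L^m', with
    e + m' + 1 <= D^4 * (e + m + 1). *)
Lemma tower_size_leq L D e k n : 1 < L -> 1 < D -> D.+1 <= L ^ D.+1 ->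
  k <= L ^ e -> tower_size D k D n <= L ^ (D ^ (4 * n) * (e + 1)).
Proof.
move=> L1 D1 DL ke; have L0 := ltnW L1.
suff [m le_m le_L] : exists2 m, e + m + 1 <= D ^ (4 * n) * (e + 1) & tower_size D k D n <= L ^ m.
  by apply: (leq_trans le_L); rewrite leq_exp2l //; lia.
elim: n => [|n [m le_m le_L]]; first by exists 0; rewrite ?muln0 ?expn0 //; lia.
exists (D.+1 * (1 + (e + m * (2 * D)))).
  rewrite mulnS expnD -mulnA.
  apply: leq_trans (leq_mul (leqnn (D ^ 4)) le_m).
  have H1 : D.+1 * (2 * D) + 1 <= D ^ 4.
    have : 2 * D <= D * D by rewrite leq_mul.
    by rewrite !expnS expn0 muln1 (mulnA D D); move: (D * D) => Y; nia.
  have H2 : 1 + (e + m * (2 * D)) <= 2 * D * (e + m + 1) by nia.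
  have H3 := leq_mul (leqnn D.+1) H2.
  apply: leq_trans (leq_mul H1 (leqnn (e + m + 1))); lia.
rewrite -[tower_size _ _ _ n.+1]/(D.+1 * (k * tower_size D k D n ^ (2 * D)) ^ D.+1).
rewrite mulnDr muln1 [in leqRHS]expnD leq_mul // [D.+1 * _]mulnC [in leqRHS]expnM leq_exp2r //.
rewrite expnD leq_mul // [in leqRHS]expnM leq_exp2r //; lia.
Qed.

(** n * t bounds the degree of a polynomial with exponents at most t, and the
    other factor counts such polynomials with coefficients in [-k, k]. *)
Definition avoid_deg n t k := n * t * (2 * k).+1 ^ (t.+1 ^ n).

Definition tower_height n t k :=
  tower_size ((2 * t) ^ (2 ^ n)) (tower_norm n t k (avoid_deg n t k)) ((2 * t) ^ (2 ^ n)) n.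

(** With L = 2kt and D = (2t)^(2^n) the successive exponents of L are 5D for
    the parameters of the elimination, D^(2n+3) for the polynomials of the
    tower and D^(6n+4) for the sizes. Finally D^(6n+7) is a power of 2t with
    exponent 2^n (6n+7) <= D^64. *)
Lemma tower_height_leq n t k : 0 < n -> 0 < t -> 0 < k ->
  (tower_height n t (2 * k) * (1 + tower_height n t (2 * k))) ^ ((2 * t) ^ (2 ^ n))
    <= (2 * k * t) ^ ((2 * t) ^ ((2 * t) ^ (2 ^ (n + 6)))).
Proof.
move=> n0 t0 k0; rewrite /tower_height; set D := (2 * t) ^ (2 ^ n).
set M := tower_size _ _ _ _; pose L := 2 * k * t.
have t2 : 1 < 2 * t by lia.
have L1 : 1 < L by rewrite /L; nia.
have tL : 2 * t <= L by rewrite /L; nia.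
have kL : 2 * k <= L by rewrite /L leq_pmulr.
have n2 : n < 2 ^ n by apply: ltn_expl.
have le2D : 2 ^ (2 ^ n) <= D by rewrite /D leq_exp2r ?expn_gt0.
have n2D : 2 ^ n < D by apply: leq_trans le2D; apply: ltn_expl.
have D4 : 4 <= D.
  apply: leq_trans le2D; rewrite -[4]/(2 ^ (2 ^ 1)) leq_pexp2l // leq_pexp2l //.
have DL : D <= L ^ D.
  apply: (@leq_trans (L ^ (2 ^ n))); first by rewrite /D leq_exp2r ?expn_gt0.
  by rewrite leq_exp2l // ltnW.
have L0 := ltnW L1.
have DL1 : D.+1 <= L ^ D.+1.
  have LD0 : 0 < L ^ D by rewrite expn_gt0 L0.
  by rewrite expnS; nia.
set K := tower_norm _ _ _ _ in M *.
have le_k : 2 * k <= L ^ (5 * D).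
  apply: (leq_trans kL); rewrite -[X in X <= _]expn1 leq_exp2l //; lia.
have le_g : avoid_deg n t (2 * k) <= L ^ (5 * D).
  rewrite /avoid_deg (_ : 5 * D = (D + D) + 3 * D); last lia.
  rewrite expnD leq_mul //.
    rewrite expnD leq_mul //.
      by rewrite (leq_trans _ DL) //; lia.
    rewrite (leq_trans _ DL) // (leq_trans _ (_ : 2 * t <= D)) //; first by lia.
    by rewrite /D -[X in X <= _]expn1 leq_pexp2l ?expn_gt0 //; lia.
  apply: (@leq_trans ((L ^ 3) ^ (t.+1 ^ n))).
    by rewrite leq_exp2r ?expn_gt0 // !expnS expn0 muln1; clearbody L; nia.
  rewrite -expnM leq_exp2l // leq_mul //.
  apply: (@leq_trans ((2 * t) ^ n)); first by rewrite leq_exp2r //; lia.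
  by rewrite /D leq_pexp2l // ltnW.
have g0 : 0 < avoid_deg n t (2 * k) by rewrite !muln_gt0 n0 t0 expn_gt0.
have le_K : K <= L ^ (D ^ (2 * n + 3)).
  apply: leq_trans (tower_norm_leq L1 _ DL t0 g0 (leqnn _) le_k le_g) _; first lia.
  rewrite leq_exp2l // expnD leq_mul // !expnS expn0; nia.
have D1 : 1 < D by lia.
have le_M : M <= L ^ (D ^ (6 * n + 4)).
  apply: leq_trans (tower_size_leq n L1 D1 DL1 le_K) _.
  rewrite leq_exp2l // (_ : 6 * n + 4 = 4 * n + (2 * n + 4)); last lia.
  rewrite [in leqRHS]expnD leq_mul // [2 * n + 4]addnS expnS.
  have : 0 < D ^ (2 * n + 3) by rewrite expn_gt0 (ltnW D1).
  by move: (D ^ _) => X; nia.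
set X := D ^ (6 * n + 4) in le_M.
have X0 : 0 < X by rewrite expn_gt0 (ltnW D1).
apply: (@leq_trans ((L ^ (3 * X)) ^ D)).
  rewrite leq_exp2r ?(ltnW D1) //.
  rewrite (_ : 3 * X = X + (X + X)); last lia.
  rewrite 2!expnD leq_mul //.
  have LX : 2 <= L ^ X.
    by apply: (leq_trans L1); rewrite -[X in X <= _]expn1 leq_exp2l.
  by move: (L ^ X) LX le_M => Y *; nia.
rewrite -expnM leq_exp2l //.
apply: (@leq_trans (D ^ (6 * n + 7))).
  have -> : D ^ (6 * n + 7) = X * (D ^ 2 * D).
    by rewrite /X -expnSr -expnD; congr (_ ^ _); lia.
  rewrite -mulnA mulnCA leq_mul // leq_mul // expnS expn1.
  by apply: (leq_trans (_ : 3 <= 4 * 4)) => //; apply: leq_mul.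
rewrite /D -expnM leq_exp2l //.
rewrite -/D expnD expnM -/D (_ : 2 ^ 6 = 3 + 61) // expnD -/D.
have le_n : 6 * n + 7 <= D ^ 3 by rewrite !expnS expn0; nia.
rewrite mulnC leq_mul //.
rewrite (leq_trans (ltnW n2D)) // -[X in X <= _]expn1 leq_pexp2l //; lia.
Qed.

Local Open Scope ring_scope.

(** * The finite set of polynomials involved *)

(** Normal forms of polynomials, indexed by a finite type: coefficients are in
    [-k, k] and exponents in [0, t]. *)
Definition dense_polyfun n t k (v : {ffun {ffun 'I_n -> 'I_t.+1} -> 'I_(2 * k).+1})
    (x : nat -> algC) : algC :=
  \sum_e ((v e)%:Z - k%:Z)%:~R * \prod_(i < n) x i ^+ e i.

Lemma dense_polyfun_deg n t k v : polyfun_deg n (n * t) (@dense_polyfun n t k v).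
Proof.
exists (\sum_e `|(v e)%:Z - k%:Z|)%N.
(* The exponents are extended by 0 to variables outside the first n. *)
exists [seq ((v e)%:Z - k%:Z, fun l => if insub l is Some i then val (e i) else 0%N)
   | e <- index_enum {ffun 'I_n -> 'I_t.+1}].
split=> [||x].
- by rewrite big_map.
- rewrite all_map; apply/allP => e _ /=.
  rewrite -[n in (_ <= n * _)%N]card_ord -sum_nat_const; apply: leq_sum => i _.
  by rewrite valK -ltnS.
- rewrite big_map; apply: eq_bigr => e _; rewrite /monom_val /=; congr (_ * _).
  by apply: eq_bigr => i _; rewrite valK.
Qed.

Lemma polyfun_dense n t k F : polyfun n t k F -> exists v, F =1 @dense_polyfun n t k v.
Proof.
move=> [L [Lk Lt LF]].
pose key (m : int * (nat -> nat)) : {ffun 'I_n -> 'I_t.+1} := [ffun i : 'I_n => inord (m.2 i)].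
pose c e := \sum_(m <- L | key m == e) m.1.
have ck e : (`|c e| <= k)%N.
  apply: leq_trans Lk; apply: (@leq_trans (\sum_(m <- L | key m == e) `|m.1|)).
    by rewrite /c; elim/big_rec2: _ => // m u w _; lia.
  by rewrite [leqRHS](bigID (fun m => key m == e)) leq_addr.
(* Shift by k, since coefficients are encoded by [0, 2k]. *)
exists [ffun e => inord `|c e + k%:Z|] => x.
rewrite LF (partition_big key xpredT) //; apply: eq_bigr => e _.
have -> : ([ffun e => inord `|c e + k%:Z|] e : 'I_(2 * k).+1)%:Z - k%:Z = c e.
  by rewrite ffunE inordK; have := ck e; lia.
rewrite /c rmorph_sum mulr_suml big_seq_cond [RHS]big_seq_cond; apply: eq_bigr => m.
move=> /andP[/(allP Lt) le_t /eqP <-]; rewrite /monom_val; congr (_ * _).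
apply: eq_bigr => i _; rewrite ffunE inordK // ltnS (leq_trans _ le_t) //.
by rewrite (bigD1 i) //= leq_addr.
Qed.

(** The product of the normal forms that do not vanish at a. Counting normal
    forms, not the polynomials of the problem, makes the degree independent of
    r and s. *)
Lemma exists_avoiding n t k (a : nat -> algC) : exists G,
  [/\ polyfun_deg n (avoid_deg n t k) G, G a != 0 &
      forall b F, polyfun n t k F -> F a != 0 -> G b != 0 -> F b != 0].
Proof.
pose P (v : {ffun {ffun 'I_n -> 'I_t.+1} -> 'I_(2 * k).+1}) := dense_polyfun v a != 0.
exists (fun x => \prod_(v | P v) dense_polyfun v x); split.
- have /choice[l Hl] := @dense_polyfun_deg n t k.
  exists ((\max_v l v) ^ count P (index_enum _))%N.
  have polyP := polyfun_prod (index_enum _) (P := P) (fun v _ =>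
    polyfunW (leqnn _) (leq_bigmax (F := l) v) (Hl v)).
  apply: polyfunW (leqnn _) polyP.
  rewrite mulnC /avoid_deg leq_mul // (leq_trans (count_size _ _)) // size_index_enum.
  by rewrite card_ffun card_ord card_ffun !card_ord.
- by apply/prodf_neq0.
- move=> b F /polyfun_dense[v Dv]; rewrite !Dv => Pv /prodf_neq0; exact.
Qed.

Lemma polyfun_diff n t k i j : (i < n)%N -> (j < n)%N -> (0 < t)%N -> (1 < k)%N ->
  polyfun n t k (fun x => x i - x j).
Proof.
move=> lt_i lt_j t0 k1.
exact: polyfunW (polyfunD (polyfun_var lt_i) (polyfunN (polyfun_var lt_j))).
Qed.

Lemma polyfun_mpoly_eval n t k s (P : mpoly s int) (idx : 'I_s -> nat) :
    (forall j, (idx j < n)%N) -> mpoly_deg_le P t -> (mpoly_norm1 P <= k)%N ->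
  polyfun n t k (fun x => mpoly_eval P (fun j => x (idx j))).
Proof.
move=> idx_n degP normP.
exists [seq (mcoeff m P, fun l => \sum_(j | idx j == l) m j)%N | m <- msupp P]; split.
- by rewrite big_map.
- rewrite all_map; apply/allP => m mP /=.
  have le_t : (\sum_(j < s) m j <= t)%N.
    rewrite -mpoly.mdegE -ltnS; apply: leq_trans degP.
    exact: mpoly.mmeasure_mnm_lt.
  apply: leq_trans le_t.
  by rewrite [leqRHS](partition_big (fun j => Ordinal (idx_n j)) xpredT).
move=> x; rewrite big_map; apply: eq_bigr => m _; rewrite /monom_val /=; congr (_ * _).
rewrite /mmap1 (partition_big (fun j => Ordinal (idx_n j)) xpredT) //=; apply: eq_bigr => i _.
rewrite -prodrXr; apply: eq_big => // j; rewrite -val_eqE /= => /eqP <-; reflexivity.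
Qed.

(** * The point with the same vanishing pattern *)

Lemma tower_ext_degree n d t k (b : nat -> algC) (S : {fset algC}) :
    tower n d t k b -> (forall c, c \in S -> exists2 i, (i < n)%N & b i = c) ->
    (forall i, (i < n)%N -> b i \in S) ->
  (ext_degree S <= \prod_(i < n) d i)%N.
Proof.
move=> tow Sb bS; rewrite /ext_degree; case: (num_field_exists _) => Q /= [QC [s Ds genQ]].
have /choice[z zb] : forall i, exists w, (i < n)%N -> QC w = b i.
  move=> i; have [lt_in|] := boolP (i < n)%N; last by exists 0.
  have : b i \in map QC s by rewrite Ds; apply: bS.
  by case/mapP => w _ Dw; exists w.
apply: leq_trans (tower_dim tow zb); apply: dimvS; rewrite -genQ.
apply/Fadjoin_seqP; split; first exact: sub1v.
move=> w ws; have : QC w \in S by rewrite -[QC w \in S]/(QC w \in enum_fset S) -Ds map_f.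
case/Sb => i lt_in bw; rewrite (_ : w = z i).
  by apply/seqv_sub_adjoin/map_f; rewrite mem_iota.
by apply: (fmorph_inj QC); rewrite zb.
Qed.

(** A specialization of a where the avoiding polynomial G is nonzero has the
    same vanishing pattern as a. *)
Lemma same_pattern_low_height n t k (a : nat -> algC) :
    (0 < n)%N -> (0 < t)%N -> (0 < k)%N ->
  exists b : nat -> algC,
   [/\ forall F, polyfun n t (2 * k) F -> (F a == 0) = (F b == 0),
       forall S : {fset algC}, (forall c, c \in S -> exists2 i, (i < n)%N & b i = c) ->
         (forall i, (i < n)%N -> b i \in S) -> (ext_degree S <= (2 * t) ^ (2 ^ n))%N &
       forall i, (i < n)%N -> (poly_norm1 (minpolyZ (b i)) <=
         (2 * k * t) ^ ((2 * t) ^ ((2 * t) ^ (2 ^ (n + 6)))))%N].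
Proof.
move=> n0 t0 k0; have k20 : (0 < 2 * k)%N by rewrite muln_gt0.
have [G [degG Ga G_avoid]] := exists_avoiding n t (2 * k) a.
have [b [d [spec Gb tow d0 prod_d]]] := specialize_to_tower t0 k20 degG Ga.
have t20 : (0 < 2 * t)%N by rewrite muln_gt0.
set D := ((2 * t) ^ (2 ^ n))%N in tow *.
have le_D : (\prod_(i < n) d i <= D)%N.
  by apply: (leq_trans prod_d); rewrite leq_pexp2l // leq_subr.
have D0 : (0 < D)%N by rewrite expn_gt0 t20.
set K := tower_norm _ _ _ _ in tow.
have K0 : (0 < K)%N by rewrite /K; case: (n) n0 => // m _; rewrite /= !leq_max k20.
exists b; split.
- move=> F polyF; apply/eqP/eqP; first exact: spec.
  by move=> Fb; apply/eqP; apply: contraPT Fb => Fa; apply/eqP/(G_avoid b F).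
- by move=> S Sb bS; apply: leq_trans (tower_ext_degree tow Sb bS) le_D.
move=> i lt_in.
have [q /andP[q0 le_q] szd] := tower_sized D0 K0 d0 le_D tow.
have polyi : polyfun n 1 1 (fun x => x i) by apply: polyfun_var.
have szD : (size (minCpoly (b i)) <= D.+1)%N.
  by apply: leq_trans (tower_size_minCpoly tow (leqnn n) polyi) _.
apply: leq_trans (minpolyZ_norm_le q0 (szd i lt_in) szD) _.
apply: leq_trans (tower_height_leq n0 t0 k0).
by rewrite leq_exp2r // leq_mul.
Qed.

Unset Implicit Arguments.

Theorem theorem5p6 (R : realType) (grh : GRH R) :
  exists2 C : R, 0 < C &
  forall (r s t k : nat) (P : 'I_r -> mpoly s int),
    (0 < r)%N -> (0 < s)%N -> (0 < t)%N -> (0 < k)%N ->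
    (forall i, mpoly_deg_le (P i) t) ->
    (forall i, (mpoly_norm1 (P i) <= k)%N) ->
    forall A : {fset algC},
      (ext_degree A <= (2 * t) ^ (2 ^ #|` A|))%N ->
      exists B : {fset algC},
        [/\ freiman_isomorphic P A B,
            (ext_degree B <= (2 * t) ^ (2 ^ #|` A|))%N &
            (Env B)%:R <= C * ((r ^ 2 * #|` A| ^ (4 * s) *
              (2 * k * t) ^ ((2 * t) ^ ((2 * t) ^ (2 ^ (#|` A| + 6)))))%N)%:R].
Proof.
exists 1 => // r s t k P r0 s0 t0 k0 degP normP A degA.
have [n0|] := posnP #|` A|.
  exists A; split=> //.
    by exists id; split=> //; exists id.
  by rewrite /Env (size0nil (n0 : size (enum_fset A) = 0)) big_nil mul1r ler0n.
set n := #|` A| in degA * => n0.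
pose a i := nth 0 (enum_fset A) i.
have [b [patt degb normb]] := same_pattern_low_height a n0 t0 k0.
have idxP (x : A) : (index (val x) (enum_fset A) < n)%N by rewrite index_mem; apply: valP.
pose idx (x : A) := Ordinal (idxP x).
have a_idx x : a (idx x) = val x by rewrite /a nth_index //; apply: valP.
have a_inj i j : (i < n)%N -> (j < n)%N -> a i = a j -> i = j.
  move=> lt_i lt_j /eqP; rewrite /a nth_uniq //; first by move/eqP.
  exact: fset_uniq.
have b_inj i j : (i < n)%N -> (j < n)%N -> b i = b j -> i = j.
  move=> lt_i lt_j bij; apply: a_inj => //; apply/eqP.
  rewrite -subr_eq0 (patt (fun x => x i - x j)) ?bij ?subrr //.
  by apply: polyfun_diff => //; lia.
pose B := seq_fset tt (mkseq b n).
have bB i : (i < n)%N -> b i \in B.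
  by move=> lt_i; rewrite seq_fsetE map_f // mem_iota.
have Bb c : c \in B -> exists2 i, (i < n)%N & b i = c.
  by rewrite seq_fsetE => /mapP[i]; rewrite mem_iota => lt_i ->; exists i.
pose psi (x : A) : B := [` bB _ (ltn_ord (idx x)) ]%fset.
have psi_inj : injective psi.
  move=> x y /(congr1 val) /= /b_inj -/(_ (idxP x) (idxP y)) xy; apply: val_inj.
  by rewrite -!a_idx /= xy.
exists B; split.
- exists psi; split.
    apply: inj_card_bij => //; rewrite -!cardfE.
    by rewrite size_seq_fset (leq_trans (size_undup _)) // size_mkseq.
  move=> x; have evalE i : (mpoly_eval (P i) (fun j => val (x j)) == 0) =
      (mpoly_eval (P i) (fun j => val (psi (x j))) == 0).
    pose F y := mpoly_eval (P i) (fun j => y (val (idx (x j)))).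
    have polyF : polyfun n t (2 * k) F.
      apply: polyfun_mpoly_eval => // [j|]; first exact: ltn_ord.
      by rewrite (leq_trans (normP i)) // leq_pmull.
    rewrite -(patt F polyF) /F; congr (mpoly_eval _ _ == 0).
    by apply/funext => j; rewrite a_idx.
  by split=> H i; apply/eqP; [rewrite -evalE | rewrite evalE]; apply/eqP.
- exact: degb.
rewrite mul1r ler_nat; apply: leq_trans (leq_pmull _ _); last by rewrite muln_gt0 !expn_gt0 r0 n0.
by apply/bigmax_leqP_seq => c /Bb[i lt_i <-] _; apply: normb.
Qed.
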